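(* There is a polynomial-time algorithm which, given a finite simple undirected graph $G$, decides whether $\alpha(G)=a(G)$.
   Context: For a finite simple undirected graph $G$ with $n\ge 1$ vertices, $m$ edges, and degree sequence $d_1\le d_2\le\cdots\le d_n$ (vertex degrees sorted in nondecreasing order), the annihilation number is $a(G)=\max\{a\in\{1,\ldots,n\}: d_1+\cdots+d_a\le m\}$. The independence number $\alpha(G)$ is the maximum cardinality of a set of pairwise non-adjacent vertices of $G$. Polynomial time is measured in the size of $G$. *)

(* Defs.v *)
From mathcomp Require Import all_boot.

Set Implicit Arguments.
Unset Strict Implicit.
Unset Printing Implicit Defensive.

Record sgraph (V : finType) := SGraph {
  adj : rel V;
  adj_sym : symmetric adj;
  adj_irr : irreflexive adj
}.

Section GraphParameters.

Variables (V : finType) (G : sgraph V).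

Definition edges : {set {set V}} :=
  [set [set e.1; e.2] | e : V * V & adj G e.1 e.2].

Definition deg (x : V) : nat := #|[set y | adj G x y]|.

Definition degree_sequence : seq nat := sort leq [seq deg x | x <- enum V].

(* For a nonempty vertex set, k = 1 satisfies the condition, so this is a
   maximum over a nonempty set (an empty \max would be 0). *)
Definition annihilation_number : nat :=
  \max_(1 <= k < #|V|.+1 | sumn (take k degree_sequence) <= #|edges|) k.

Definition independent (S : {set V}) : bool :=
  [forall x in S, forall y in S, ~~ adj G x y].

Definition independence_number : nat :=
  \max_(S : {set V} | independent S) #|S|.

End GraphParameters.

(* Algorithms are programs of a random access machine in the style of Cook and
   Reckhow: registers X_0, X_1, ... hold natural numbers and are initially 0,
   and the input is a read-only finite array of natural numbers.  Every
   instruction has unit cost.  As there is no multiplication, the bit length of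
   the largest number among the program constants, the input and the registers
   grows by at most 1 per step, so polynomial time on this machine is
   polynomial time on a Turing machine. *)
Inductive instr :=
| IConst of nat & nat       (* X_i <- c *)
| IAdd of nat & nat & nat   (* X_i <- X_j + X_k *)
| ISub of nat & nat & nat   (* X_i <- max(X_j - X_k, 0) *)
| ILoad of nat & nat        (* X_i <- X_(X_j) *)
| IStore of nat & nat       (* X_(X_i) <- X_j *)
| IRead of nat & nat        (* X_i <- input cell number X_j; 0 if none *)
| IJpos of nat & nat.       (* go to instruction l if X_i > 0 *)

Definition program := seq instr.

Record config := Config { pc : nat; regs : nat -> nat }.

Definition upd (r : nat -> nat) (i v : nat) : nat -> nat :=
  fun k => if k == i then v else r k.

Definition exec (input : seq nat) (c : instr) (s : config) : config :=
  let: Config l r := s in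
  match c with
  | IConst i v => Config l.+1 (upd r i v)
  | IAdd i j k => Config l.+1 (upd r i (r j + r k))
  | ISub i j k => Config l.+1 (upd r i (r j - r k))
  | ILoad i j => Config l.+1 (upd r i (r (r j)))
  | IStore i j => Config l.+1 (upd r (r i) (r j))
  | IRead i j => Config l.+1 (upd r i (nth 0 input (r j)))
  | IJpos i l' => Config (if 0 < r i then l' else l.+1) r
  end.

(* The machine has halted, and then no longer moves, once the program counter
   is outside the program. *)
Definition step (p : program) (input : seq nat) (s : config) : config :=
  if onth p (pc s) is Some c then exec input c s else s.

Definition init : config := Config 0 (fun=> 0).

Definition run (p : program) (input : seq nat) (t : nat) : config :=
  iter t (step p input) init.

(* p halts on input within t steps and answers b: X_0 is then 1 for yes and
   0 for no. *)
Definition answers_within (p : program) (input : seq nat) (t : nat) (b : bool)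
  : Prop :=
  size p <= pc (run p input t) /\ regs (run p input t) 0 = b.

(* The number of vertices, then the adjacency matrix row by row. *)
Definition encode (n : nat) (G : sgraph 'I_n) : seq nat :=
  n :: [seq (adj G i j : nat) | i <- enum 'I_n, j <- enum 'I_n].

Definition graph_size (n : nat) (G : sgraph 'I_n) : nat := n + #|edges G|.

(* Main.v *)
Require Import Defs.
From mathcomp Require Import all_boot all_order all_algebra.
From mathcomp Require Import zify.

Set Implicit Arguments.
Unset Strict Implicit.
Unset Printing Implicit Defensive.

(* Let M be a maximum matching of the bipartite double cover of G and let C be a
   vertex cover of G.  Then 2|C| = |M| + v, where v counts the edges ij of M
   with i and j both in C and the unmatched copies of vertices of C.  If
   x |-> y x / 2 is a fractional independent set, summing y over all edge ends
   gives \sum_x y x * deg x <= 2m, whence \sum_x y x <= 2a + 1.  For y integral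
   this says that alpha <= a; for y dual to M it says that |M| >= 2(n - a) - 1.
   Hence alpha = a if and only if |M| <= 2(n - a) and some cover has v <= 1.
   Guessing the one item that may be counted by v leaves an instance of 2-SAT.
   The matching is found by an auction with unit price increments, and 2-SAT is
   decided by reachability in the implication graph.

   The algorithm is written in a language whose only loops run over 0, ..., n-1,
   so that its compilation to the random access machine runs in polynomial time
   whatever the program. *)

(** * Loop programs and their compilation *)

(** Matching and y are linked as in König's theorem: a vertex cover of the double cover with at most
    |M| elements yields y x, the number of copies of x outside it, with sum at least 2n - |M|. An
    edge uv of G stands for two edges of the double cover, whence y u + y v <= 2. The slack of one
    in |M| >= 2(n - a) - 1 is what lets v be 1: if |C| = n - a then v = 2(n - a) - |M| <= 1.
    Conversely, |M| <= 2(n - a) and v <= 1 give 2|C| <= 2(n - a) + 1, where parity removes the 1.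
    The condition defining a is replaced by the inequalities k t <= m + \sum_x max(t - deg x, 0) for
    all t < n. They serve twice: the bound on the sum of y is obtained by verifying them, and they
    let the program compute a without sorting. An auction suits a language without unbounded loops:
    its state is two arrays, its final prices give the dual y directly, and the sum of the prices
    bounds the number of rounds in advance. *)

Inductive expr :=
| Cst of nat
| Add of expr & expr
| Sub of expr & expr
| Get of nat & expr
| Inp of expr.

(* For A c runs c for each value of cell 0 of A below n, the input cell 0; the
   loop counter itself is out of reach of c. *)
Inductive cmd :=
| Skip
| Put of nat & expr & expr
| Seq of cmd & cmd
| If of expr & cmd & cmd
| For of nat & cmd.

Definition store := nat -> nat -> nat.

Definition put (s : store) (A i v : nat) : store :=
  fun B k => if (B == A) && (k == i) then v else s B k.

Fixpoint eval (inp : seq nat) (s : store) (e : expr) : nat :=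
  match e with
  | Cst c => c
  | Add e1 e2 => eval inp s e1 + eval inp s e2
  | Sub e1 e2 => eval inp s e1 - eval inp s e2
  | Get A e => s A (eval inp s e)
  | Inp e => nth 0 inp (eval inp s e)
  end.

Fixpoint den (inp : seq nat) (c : cmd) (s : store) : store :=
  match c with
  | Skip => s
  | Put A e1 e2 => put s A (eval inp s e1) (eval inp s e2)
  | Seq c1 c2 => den inp c2 (den inp c1 s)
  | If e c1 c2 => if 0 < eval inp s e then den inp c1 s else den inp c2 s
  | For A c =>
      foldl (fun s k => den inp c (put s A 0 k)) s (iota 0 (nth 0 inp 0))
  end.

(* Registers 0-7 are temporaries, register 8 + d is the counter of the loop at
   nesting depth d < 24, and cell i of array A < 32 is register
   A + 32 * (i + 1).  Five doublings of X_t multiply it by 32. *)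
Definition locate (A t : nat) : seq instr :=
  nseq 5 (IAdd t t t) ++ [:: IConst t.+1 (A + 32); IAdd t t t.+1].

Fixpoint compile_expr (t : nat) (e : expr) : seq instr :=
  match e with
  | Cst c => [:: IConst t c]
  | Add e1 e2 => compile_expr t e1 ++ compile_expr t.+1 e2 ++ [:: IAdd t t t.+1]
  | Sub e1 e2 => compile_expr t e1 ++ compile_expr t.+1 e2 ++ [:: ISub t t t.+1]
  | Get A e => compile_expr t e ++ locate A t ++ [:: ILoad t t]
  | Inp e => compile_expr t e ++ [:: IRead t t]
  end.

Fixpoint compile (d l : nat) (c : cmd) : seq instr :=
  match c with
  | Skip => [::]
  | Put A e1 e2 =>
      compile_expr 0 e1 ++ locate A 0 ++ compile_expr 1 e2 ++ [:: IStore 0 1]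
  | Seq c1 c2 =>
      let q1 := compile d l c1 in q1 ++ compile d (l + size q1) c2
  | If e c1 c2 =>
      let q := compile_expr 0 e in
      let q2 := compile d (l + size q + 1) c2 in
      let l1 := l + size q + 1 + size q2 + 2 in
      let q1 := compile d l1 c1 in
      q ++ [:: IJpos 0 l1] ++ q2 ++ [:: IConst 0 1; IJpos 0 (l1 + size q1)] ++ q1
  | For A c =>
      let q := compile d.+1 (l + 9) c in
      [:: IConst (8 + d) 0;
          IConst 0 0; IRead 0 0; ISub 0 0 (8 + d); IJpos 0 (l + 7);
          IConst 0 1; IJpos 0 (l + 9 + size q + 3);
          IConst 0 0; IAdd (A + 32) (8 + d) 0] ++
      q ++ [:: IConst 0 1; IAdd (8 + d) (8 + d) 0; IJpos 0 (l + 1)]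
  end.

(** Code compiled at temporary t uses temporaries from t upwards only, and [locate] also overwrites
    t + 1. The bounds keep the temporaries below 8, the loop counters below 32 and the arrays in
    distinct residue classes modulo 32, so that no two uses of a register collide. *)
Fixpoint expr_ok (t : nat) (e : expr) : bool :=
  match e with
  | Cst _ => t < 8
  | Add e1 e2 | Sub e1 e2 => expr_ok t e1 && expr_ok t.+1 e2
  | Get A e => [&& A < 32, t.+1 < 8 & expr_ok t e]
  | Inp e => expr_ok t e
  end.

Fixpoint cmd_ok (d : nat) (c : cmd) : bool :=
  match c with
  | Skip => true
  | Put A e1 e2 => [&& A < 32, expr_ok 0 e1 & expr_ok 1 e2]
  | Seq c1 c2 => cmd_ok d c1 && cmd_ok d c2
  | If e c1 c2 => [&& expr_ok 0 e, cmd_ok d c1 & cmd_ok d c2]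
  | For A c => [&& A < 32, d < 24 & cmd_ok d.+1 c]
  end.

(** Both branches of an [If] are charged, so the bound depends on the input only through n. In a
    loop, 7 pays for the initialisation and the final failing test, and 9 for the test, the copy of
    the counter, the increment and the jump back. *)
Fixpoint cost (n : nat) (c : cmd) : nat :=
  match c with
  | Skip => 0
  | Put A e1 e2 => size (compile 0 0 (Put A e1 e2))
  | Seq c1 c2 => cost n c1 + cost n c2
  | If e c1 c2 => size (compile_expr 0 e) + 3 + (cost n c1 + cost n c2)
  | For A c => 7 + n * (9 + cost n c)
  end.

Definition jump (c : instr) : bool := if c is IJpos _ _ then true else false.

(** * Simulation of loop programs by the machine *)

Section Machine.

Variables (p : program) (inp : seq nat).

(** The effect of an instruction on the registers does not depend on the program counter, so 0 is a
    dummy value; the jumps are ignored, and the function is used on jump-free code. *)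
Definition exec_seq (cs : seq instr) (r : nat -> nat) : nat -> nat :=
  foldl (fun r c => regs (exec inp c (Config 0 r))) r cs.

Definition code_at (l : nat) (cs : seq instr) : Prop :=
  forall k c, onth cs k = Some c -> onth p (l + k) = Some c.

Definition runs (t l : nat) (r : nat -> nat) (l' : nat) (r' : nat -> nat) :=
  exists2 u, u <= t & iter u (step p inp) (Config l r) = Config l' r'.

Lemma onth_cat_l (T : Type) (s1 s2 : seq T) k x :
  onth s1 k = Some x -> onth (s1 ++ s2) k = Some x.
Proof. by elim: s1 k => [|y s1 IH] [|k] //=; apply: IH. Qed.

Lemma onth_cat_r (T : Type) (s1 s2 : seq T) k :
  onth (s1 ++ s2) (size s1 + k) = onth s2 k.
Proof. by elim: s1 => //= y s1 ->. Qed.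

Lemma code_at_cat l cs1 cs2 :
  code_at l (cs1 ++ cs2) -> code_at l cs1 /\ code_at (l + size cs1) cs2.
Proof.
move=> H; split=> k c Hk; first by apply/H/onth_cat_l.
by rewrite -addnA; apply: H; rewrite onth_cat_r.
Qed.

Lemma runs_refl l r : runs 0 l r l r.
Proof. by exists 0. Qed.

Lemma runs_trans t1 t2 l1 r1 l2 r2 l3 r3 :
  runs t1 l1 r1 l2 r2 -> runs t2 l2 r2 l3 r3 -> runs (t1 + t2) l1 r1 l3 r3.
Proof.
case=> u1 H1 E1 [u2 H2 E2]; exists (u2 + u1); first by rewrite addnC leq_add.
by rewrite iterD E1.
Qed.

Lemma runs_weaken t1 t2 l r l' r' :
  t1 <= t2 -> runs t1 l r l' r' -> runs t2 l r l' r'.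
Proof. by move=> le12 [u Hu E]; exists u => //; apply: leq_trans le12. Qed.

Lemma runs_to t l r l1 l2 r' : runs t l r l1 r' -> l1 = l2 -> runs t l r l2 r'.
Proof. by move=> R <-. Qed.

Lemma runs_join t1 t2 l1 r1 l2 l2' r2 l3 r3 :
  runs t1 l1 r1 l2 r2 -> runs t2 l2' r2 l3 r3 -> l2 = l2' ->
  runs (t1 + t2) l1 r1 l3 r3.
Proof. by move=> R1 R2 E; apply: runs_trans R2; rewrite -E. Qed.

Lemma runs_step c l r : code_at l [:: c] ->
  runs 1 l r (pc (exec inp c (Config l r))) (regs (exec inp c (Config l r))).
Proof.
move=> Hc; exists 1 => //=; rewrite /step /=.
move: (Hc 0 c erefl); rewrite addn0 => ->.
by case: c {Hc}.
Qed.

Lemma runs_seq cs l r : code_at l cs -> ~~ has jump cs ->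
  runs (size cs) l r (l + size cs) (exec_seq cs r).
Proof.
elim: cs l r => [|c cs IH] l r /=; first by rewrite addn0 => _ _; apply: runs_refl.
rewrite negb_or => Hcs /andP[Jc Jcs].
have [Hc {}Hcs] : code_at l [:: c] /\ code_at (l + 1) cs.
  by apply: code_at_cat.
rewrite -add1n addnA; apply: runs_trans (IH _ _ Hcs Jcs).
by have := runs_step r Hc; case: (c) Jc => //= *; rewrite addn1.
Qed.

Lemma runs_jump l r i l' : code_at l [:: IJpos i l'] ->
  runs 1 l r (if 0 < r i then l' else l + 1) r.
Proof. by move/(runs_step r); rewrite addn1. Qed.

Definition represents (r : nat -> nat) (s : store) : Prop :=
  forall A i, A < 32 -> r (A + 32 * i.+1) = s A i.

Lemma exec_seq_cat cs1 cs2 r :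
  exec_seq (cs1 ++ cs2) r = exec_seq cs2 (exec_seq cs1 r).
Proof. exact: foldl_cat. Qed.

Lemma compile_expr_jump t e : ~~ has jump (compile_expr t e).
Proof.
elim: e t => //= [e1 IH1 e2 IH2|e1 IH1 e2 IH2|A e IH|e IH] t;
  by rewrite !has_cat !negb_or ?IH1 ?IH2 ?IH.
Qed.

Lemma exec_locate A t r : t.+1 < 8 ->
  exec_seq (locate A t) r t = A + 32 * (r t).+1 /\
  forall k, k != t -> k != t.+1 -> exec_seq (locate A t) r k = r k.
Proof.
move=> lt8; rewrite /exec_seq /locate /= /upd !eqxx.
have -> : (t == t.+1) = false by apply/eqP; lia.
split; first lia.
by move=> k /negPf -> /negPf ->.
Qed.

Lemma expr_ok_lt t e : expr_ok t e -> t < 8.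
Proof.
elim: e t => [c|e1 IH1 e2 IH2|e1 IH1 e2 IH2|A e IH|e IH] t //=.
- by case/andP=> /IH1.
- by case/andP=> /IH1.
- by case/and3P=> _ _ /IH.
- exact: IH.
Qed.

Lemma represents_eq r r' s : (forall k, 8 <= k -> r' k = r k) ->
  represents r s -> represents r' s.
Proof. by move=> E rep A i ltA; rewrite E ?rep //; lia. Qed.

(** The frame clause carries the induction: k < t lets the left operand survive in its temporary
    while the right one is evaluated one temporary higher, and 8 <= k protects the counters and the
    arrays. *)
Lemma exec_compile_expr t e r s : expr_ok t e -> represents r s ->
  exec_seq (compile_expr t e) r t = eval inp s e /\
  forall k, (k < t) || (8 <= k) -> exec_seq (compile_expr t e) r k = r k.
Proof.
have binop t1 e1 e2 c f r1 :
    (forall l r, exec inp c (Config l r) = Config l.+1 (upd r t1 (f (r t1) (r t1.+1)))) ->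
    (forall t r, expr_ok t e1 -> represents r s ->
      exec_seq (compile_expr t e1) r t = eval inp s e1 /\
      forall k, (k < t) || (8 <= k) -> exec_seq (compile_expr t e1) r k = r k) ->
    (forall t r, expr_ok t e2 -> represents r s ->
      exec_seq (compile_expr t e2) r t = eval inp s e2 /\
      forall k, (k < t) || (8 <= k) -> exec_seq (compile_expr t e2) r k = r k) ->
    expr_ok t1 e1 && expr_ok t1.+1 e2 -> represents r1 s ->
    let q := compile_expr t1 e1 ++ compile_expr t1.+1 e2 ++ [:: c] in
    exec_seq q r1 t1 = f (eval inp s e1) (eval inp s e2) /\
    forall k, (k < t1) || (8 <= k) -> exec_seq q r1 k = r1 k.
  move=> Ec IH1 IH2 /andP[ok1 ok2] rep; rewrite /= !exec_seq_cat.
  have [E1 F1] := IH1 t1 r1 ok1 rep.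
  set r2 := exec_seq (compile_expr t1 e1) r1 in E1 F1 *.
  have rep2 : represents r2 s by apply: represents_eq rep => k ge8; rewrite F1 // ge8 orbT.
  have [E2 F2] := IH2 t1.+1 r2 ok2 rep2.
  set r3 := exec_seq (compile_expr _ _) r2 in E2 F2 *.
  have -> : exec_seq [:: c] r3 = upd r3 t1 (f (r3 t1) (r3 t1.+1)).
    by rewrite -[LHS]/(regs (exec inp c (Config 0 r3))) Ec.
  rewrite /upd eqxx E2 F2 ?ltnS ?leqnn // E1.
  split=> // k Hk.
  have -> : (k == t1) = false by move: (expr_ok_lt ok1) Hk; lia.
  by rewrite F2 ?F1 //; lia.
elim: e t r => [c|e1 IH1 e2 IH2|e1 IH1 e2 IH2|A e IH|e IH] t r.
- move=> /= lt8 _; rewrite /upd eqxx; split=> // k Hk.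
  by have -> : (k == t) = false by lia.
- exact: binop.
- exact: binop.
- case/and3P=> ltA lt8 ok rep.
  rewrite [compile_expr _ _]/(compile_expr t e ++ locate A t ++ [:: ILoad t t]).
  rewrite exec_seq_cat (exec_seq_cat (locate A t)).
  have [E F] := IH t r ok rep.
  set r1 := exec_seq (compile_expr t e) r in E F *.
  have rep1 : represents r1 s by apply: represents_eq rep => k ge8; rewrite F // ge8 orbT.
  have [E2 F2] := exec_locate A r1 lt8.
  set r2 := exec_seq (locate A t) r1 in E2 F2 *.
  have -> : exec_seq [:: ILoad t t] r2 = upd r2 t (r2 (r2 t)) by [].
  rewrite /upd eqxx E2 F2; try lia.
  rewrite rep1 // E; split=> // k Hk.
  have -> : (k == t) = false by lia.
  by rewrite F2 ?F //; lia.
- move=> /= ok rep; have lt8 := expr_ok_lt ok.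
  rewrite exec_seq_cat; have [E F] := IH t r ok rep.
  rewrite /= /upd eqxx E; split=> // k Hk.
  have -> : (k == t) = false by lia.
  by rewrite F.
Qed.

Lemma represents_upd r s k v : k < 32 -> represents r s ->
  represents (upd r k v) s.
Proof.
move=> ltk rep A i ltA; rewrite /upd.
have -> : (A + 32 * i.+1 == k) = false by lia.
exact: rep.
Qed.

(** Only the counters of the d enclosing loops are promised to survive: the temporaries are scratch
    space, and loops inside q use the counters from 8 + d on. *)
Definition executes (t d l : nat) (q : seq instr) (s s' : store) :=
  forall r, code_at l q -> represents r s ->
  exists r', [/\ runs t l r (l + size q) r', represents r' s'
    & forall k, 8 <= k < 8 + d -> r' k = r k].

Lemma compile_put d l A e1 e2 s : d <= 24 -> cmd_ok d (Put A e1 e2) ->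
  executes (cost (nth 0 inp 0) (Put A e1 e2)) d l (compile d l (Put A e1 e2))
    s (den inp (Put A e1 e2) s).
Proof.
move=> led /and3P[ltA ok1 ok2] r Hq rep.
exists (exec_seq (compile d l (Put A e1 e2)) r).
have [E1 F1] := exec_compile_expr ok1 rep.
have rep1 := represents_eq F1 rep.
have [E2 F2] := exec_locate A (exec_seq (compile_expr 0 e1) r) (isT : 1 < 8).
set r1 := exec_seq (compile_expr 0 e1) r in E1 F1 rep1 E2 F2.
set r2 := exec_seq (locate A 0) r1 in E2 F2.
have {}F2 k : 8 <= k -> r2 k = r1 k by move=> ge8; apply: F2; lia.
have rep2 := represents_eq F2 rep1.
have [E3 F3] := exec_compile_expr ok2 rep2.
set r3 := exec_seq (compile_expr 1 e2) r2 in E3 F3.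
have -> : exec_seq (compile d l (Put A e1 e2)) r = upd r3 (r3 0) (r3 1).
  rewrite -[compile _ _ _]/(compile_expr 0 e1 ++ locate A 0 ++
    compile_expr 1 e2 ++ [:: IStore 0 1]).
  by rewrite exec_seq_cat (exec_seq_cat (locate A 0)) exec_seq_cat.
rewrite E3 (F3 0) // E2 E1; split.
- have -> : upd r3 (A + 32 * (eval inp s e1).+1) (eval inp s e2) =
            exec_seq (compile d l (Put A e1 e2)) r.
    rewrite -[compile _ _ _]/(compile_expr 0 e1 ++ locate A 0 ++
    compile_expr 1 e2 ++ [:: IStore 0 1]).
    rewrite exec_seq_cat (exec_seq_cat (locate A 0)) exec_seq_cat.
    by rewrite -[RHS]/(upd r3 (r3 0) (r3 1)) E3 (F3 0) // E2 E1.
  apply: (runs_seq _ Hq).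
  rewrite -[compile _ _ _]/(compile_expr 0 e1 ++ locate A 0 ++
    compile_expr 1 e2 ++ [:: IStore 0 1]).
  by rewrite has_cat (has_cat _ (locate A 0)) has_cat !negb_or !compile_expr_jump.
- move=> B i ltB; rewrite /upd /= /put.
  have -> : (B + 32 * i.+1 == A + 32 * (eval inp s e1).+1) = (B == A) && (i == eval inp s e1).
    apply/eqP/andP => [E|[/eqP-> /eqP->]//]; split; apply/eqP; lia.
  have ge8 : 8 <= B + 32 * i.+1 by lia.
  by case: ifP => // _; rewrite F3 ?ge8 ?orbT //; apply: rep2.
- move=> k /andP[ge8 ltk]; rewrite /upd.
  have -> : (k == A + 32 * (eval inp s e1).+1) = false by lia.
  by rewrite F3 ?ge8 ?orbT // F2 // F1.
Qed.

Lemma compile_correct d l c s : d <= 24 -> cmd_ok d c ->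
  executes (cost (nth 0 inp 0) c) d l (compile d l c) s (den inp c s).
Proof.
elim: c d l s => [|A e1 e2|c1 IH1 c2 IH2|e c1 IH1 c2 IH2|A c IH] d l s led ok.
- by move=> r _ rep; exists r; split=> //; rewrite addn0; apply: runs_refl.
- exact: compile_put.
- case/andP: ok => ok1 ok2 r /= /code_at_cat[H1 H2] rep.
  have [r1 [R1 rep1 F1]] := IH1 d l s led ok1 r H1 rep.
  have [r2 [R2 rep2 F2]] := IH2 d _ _ led ok2 r1 H2 rep1.
  exists r2; split=> //; first by rewrite size_cat addnA; apply: runs_trans R2.
  by move=> k Hk; rewrite F2 ?F1.
- case/and3P: ok => oke ok1 ok2 r.
  set q := compile_expr 0 e.
  set q2 := compile d (l + size q + 1) c2.
  set l1 := l + size q + 1 + size q2 + 2.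
  set q1 := compile d l1 c1.
  rewrite -[compile d l _]/(q ++ [:: IJpos 0 l1] ++ q2 ++
    [:: IConst 0 1; IJpos 0 (l1 + size q1)] ++ q1).
  move=> /code_at_cat[Hq] /code_at_cat[Hj] /code_at_cat[H2] /code_at_cat[Hx H1] rep.
  have [E F] := exec_compile_expr oke rep.
  have Rq := runs_seq r Hq (compile_expr_jump 0 e).
  have {F} := F; rewrite -/q; set r0 := exec_seq q r => F.
  rewrite -/q -/r0 in E Rq.
  have rep0 := represents_eq F rep.
  have Rj := runs_jump r0 Hj; rewrite E in Rj.
  have {}Rj := runs_trans Rq Rj.
  rewrite [cost _ _]/= [den _ _ _]/= -/q.
  have -> : l + size (q ++ [:: IJpos 0 l1] ++ q2 ++
      [:: IConst 0 1; IJpos 0 (l1 + size q1)] ++ q1) = l1 + size q1.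
    by rewrite !size_cat /= !addnA.
  case: ifP Rj => _ Rj.
    rewrite /= -/l1 in H1.
    have {}H1 : code_at l1 q1 by rewrite /l1.
    have [r1 [R1 rep1 F1]] := IH1 d l1 s led ok1 r0 H1 rep0.
    exists r1; split=> //; last first.
      by move=> k Hk; rewrite F1 // F //; case/andP: Hk.
    by apply: runs_weaken (runs_trans Rj R1); lia.
  have [r1 [R1 rep1 F1]] := IH2 d _ s led ok2 r0 H2 rep0.
  rewrite -[compile _ _ c2]/q2 in R1.
  have {Hx} [Hc Hx] := code_at_cat (cs1 := [:: IConst 0 1]) Hx.
  have Rc := runs_seq r1 Hc isT.
  have Rx := runs_jump (upd r1 0 1) Hx.
  exists (upd r1 0 1); split.
  + have Rcx := runs_trans Rc Rx.
    have R1cx := runs_trans R1 Rcx.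
    apply: runs_weaken (runs_to (runs_trans Rj R1cx) _) => //.
    by rewrite /=; lia.
  + exact: represents_upd.
  + move=> k Hk; rewrite /upd; have -> : (k == 0) = false by lia.
    by rewrite F1 // F //; case/andP: Hk.
- case/and3P: ok => ltA ltd ok r.
  set q := compile d.+1 (l + 9) c.
  set lend := l + 9 + size q + 3.
  set test := [:: IConst 0 0; IRead 0 0; ISub 0 0 (8 + d)].
  set n := nth 0 inp 0.
  have -> : compile d l (For A c) = [:: IConst (8 + d) 0] ++ test ++ [:: IJpos 0 (l + 7)]
    ++ [:: IConst 0 1] ++ [:: IJpos 0 lend] ++ [:: IConst 0 0; IAdd (A + 32) (8 + d) 0]
    ++ q ++ [:: IConst 0 1; IAdd (8 + d) (8 + d) 0] ++ [:: IJpos 0 (l + 1)] by [].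
  move=> /code_at_cat[Hi] /code_at_cat[Ht] /code_at_cat[Hj] /code_at_cat[Hc]
    /code_at_cat[Hx] /code_at_cat[Ha] /code_at_cat[Hb] /code_at_cat[Hn Hl] rep.
  have shift a b cs : code_at a cs -> a = b -> code_at b cs by move=> H <-.
  have {}Hj := shift _ (l + 4) _ Hj ltac:(rewrite /=; lia).
  have {}Hc := shift _ (l + 5) _ Hc ltac:(rewrite /=; lia).
  have {}Hx := shift _ (l + 6) _ Hx ltac:(rewrite /=; lia).
  have {}Ha := shift _ (l + 7) _ Ha ltac:(rewrite /=; lia).
  have {}Hb := shift _ (l + 9) _ Hb ltac:(rewrite /=; lia).
  have {}Hn := shift _ (l + 9 + size q) _ Hn ltac:(rewrite /=; lia).
  have {}Hl := shift _ (l + 9 + size q + 2) _ Hl ltac:(rewrite /=; lia).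
  (* Induction on the number m of remaining iterations, entered at the loop test. The true counter
     stays in register 8 + d; cell 0 of A is a copy refreshed in each iteration, which the body may
     overwrite. *)
  have loop m : forall k r s, k + m = n -> r (8 + d) = k -> represents r s ->
    exists r', [/\ runs (6 + m * (9 + cost n c)) (l + 1) r lend r',
      represents r' (foldl (fun s k => den inp c (put s A 0 k)) s (iota k m))
      & forall k, 8 <= k < 8 + d -> r' k = r k].
    elim: m => [|m IHm] k r0 s0 Ek Erd rep0.
      have R1 := runs_seq r0 Ht isT.
      set r1 := exec_seq test r0 in R1.
      have E1 i : r1 i = if i == 0 then 0 else r0 i.
        rewrite /r1 /= /upd /=; case: eqP => // _.
        by rewrite Erd -/n; lia.
      have R2 := runs_jump r1 Hj; rewrite E1 /= in R2.
      have R3 := runs_seq r1 Hc isT.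
      have R4 := runs_jump (exec_seq [:: IConst 0 1] r1) Hx.
      exists (exec_seq [:: IConst 0 1] r1); split.
      + have R34 := runs_join R3 R4 ltac:(rewrite /=; lia).
        have R24 := runs_join R2 R34 ltac:(rewrite /=; lia).
        by apply: runs_weaken (runs_join R1 R24 ltac:(rewrite /=; lia)).
      + by apply: represents_upd => //; apply: represents_eq rep0 => i; rewrite E1; case: i.
      + by move=> i Hk; rewrite /= /upd E1; case: i Hk.
    have R1 := runs_seq r0 Ht isT.
    set r1 := exec_seq test r0 in R1.
    have E1 i : r1 i = if i == 0 then n - k else r0 i.
      by rewrite /r1 /= /upd /=; case: eqP => // _; rewrite Erd.
    have R2 := runs_jump r1 Hj; rewrite E1 /= in R2.
    have ltk : 0 < n - k by lia.
    rewrite ltk in R2.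
    have R3 := runs_seq r1 Ha isT.
    set r2 := exec_seq _ r1 in R3.
    have E2 i : r2 i = if i == A + 32 then k else if i == 0 then 0 else r0 i.
      rewrite /r2 /= /upd /= addn0 E1 /= Erd; case: eqP => // _.
      by case: eqP => // ?; rewrite E1; case: eqP.
    have rep2 : represents r2 (put s0 A 0 k).
      move=> B i ltB; rewrite E2 /put.
      have -> : (B + 32 * i.+1 == A + 32) = (B == A) && (i == 0).
        by apply/eqP/andP => [E|[/eqP-> /eqP->]//]; split; apply/eqP; lia.
      case: ifP => // _; have -> : (B + 32 * i.+1 == 0) = false by lia.
      exact: rep0.
    have [r3 [R4 rep3 F3]] := IH d.+1 (l + 9) _ ltd ok r2 Hb rep2.
    have R5 := runs_seq r3 Hn isT.
    set r4 := exec_seq _ r3 in R5.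
    have E4 i : r4 i = if i == 8 + d then k.+1 else if i == 0 then 1 else r3 i.
      rewrite /r4 /= /upd /= addn1 (F3 (8 + d)) ?leq_addr ?addnS //= E2 Erd.
      by have -> : (8 + d == A + 32) = false by lia.
    have R6 := runs_jump r4 Hl; rewrite E4 /= in R6.
    have rep4 : represents r4 (den inp c (put s0 A 0 k)).
      apply: represents_upd; first lia.
      exact: represents_upd.
    have E4d : r4 (8 + d) = k.+1 by rewrite E4 eqxx.
    have [r5 [R7 rep5 F5]] := IHm k.+1 r4 _ ltac:(lia) E4d rep4.
    exists r5; split=> //; last first.
      move=> i Hk; rewrite F5 // E4 F3; last lia.
      have -> : (i == 8 + d) = false by lia.
      rewrite E2; have -> : (i == A + 32) = false by lia.
      by have -> : (i == 0) = false by lia.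
    have R67 := runs_trans R6 R7.
    have R57 := runs_join R5 R67 ltac:(rewrite /=; lia).
    have R47 := runs_trans R4 R57.
    have R37 := runs_join R3 R47 ltac:(rewrite /=; lia).
    have R27 := runs_trans R2 R37.
    apply: runs_weaken (runs_join R1 R27 ltac:(rewrite /=; lia)).
    by rewrite -/n mulSn /=; lia.
  have R1 := runs_seq r Hi isT.
  have rep1 : represents (exec_seq [:: IConst (8 + d) 0] r) s.
    by apply: represents_upd => //; lia.
  have E1 : exec_seq [:: IConst (8 + d) 0] r (8 + d) = 0 by rewrite /= /upd eqxx.
  have [r1 [R2 rep2 F2]] := loop n 0 _ s (add0n n) E1 rep1.
  exists r1; split=> //.
  + apply: runs_weaken (runs_to (runs_trans R1 R2) _); first by rewrite /=; lia.
    by rewrite !size_cat /= /lend; lia.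
  + move=> k Hk; rewrite F2 // /= /upd.
    by have -> : (k == 8 + d) = false by lia.
Qed.

End Machine.

Lemma iter_step_halted p inp t s : size p <= pc s -> iter t (step p inp) s = s.
Proof.
move=> halted; elim: t => //= t ->; rewrite /step.
have -> : onth p (pc s) = None by apply: onth_default.
by [].
Qed.

Lemma compile_answers c e inp t (b : bool) : cmd_ok 0 c -> expr_ok 0 e ->
  cost (nth 0 inp 0) c + size (compile_expr 0 e) <= t ->
  eval inp (den inp c (fun _ _ => 0)) e = b ->
  answers_within (compile 0 0 c ++ compile_expr 0 e) inp t b.
Proof.
move=> okc oke let_ Eb; set q := compile 0 0 c; set qe := compile_expr 0 e.
have [Hq Hqe] : code_at (q ++ qe) 0 q /\ code_at (q ++ qe) (0 + size q) qe.
  by apply: code_at_cat => k x.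
have rep0 : represents (fun=> 0) (fun _ _ => 0) by [].
have [r [R rep _]] := compile_correct inp (leq0n 24) okc Hq rep0.
have Re := runs_seq inp r Hqe (compile_expr_jump 0 e).
have [E _] := exec_compile_expr inp oke rep.
have [u leu Eu] := runs_trans R Re.
rewrite /answers_within /run -(subnK (leq_trans leu let_)) iterD Eu.
by rewrite iter_step_halted /= ?size_cat // E.
Qed.

Lemma cost_bound c : exists a d, forall n, cost n c <= a * n.+1 ^ d.
Proof.
have weaken a d a' d' n : a <= a' -> d <= d' -> a * n.+1 ^ d <= a' * n.+1 ^ d'.
  by move=> lea led; rewrite leq_mul // leq_pexp2l.
elim: c => [|A e1 e2|c1 [a1 [d1 IH1]] c2 [a2 [d2 IH2]]
           |e c1 [a1 [d1 IH1]] c2 [a2 [d2 IH2]]|A c [a [d IH]]].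
- by exists 0, 0.
- by exists (size (compile 0 0 (Put A e1 e2))), 0 => n; rewrite expn0 muln1.
- exists (a1 + a2), (maxn d1 d2) => n /=; rewrite mulnDl leq_add //.
    by apply: leq_trans (IH1 n) _; rewrite weaken ?leq_maxl.
  by apply: leq_trans (IH2 n) _; rewrite weaken ?leq_maxr.
- exists (size (compile_expr 0 e) + 3 + (a1 + a2)), (maxn d1 d2) => n /=.
  rewrite !mulnDl !leq_add ?leq_pmulr ?expn_gt0 //.
    by apply: leq_trans (IH1 n) _; rewrite weaken ?leq_maxl.
  by apply: leq_trans (IH2 n) _; rewrite weaken ?leq_maxr.
(* With x the d-th power of n + 1, which is at least 1, 7 + n (9 + a x) <= (16 + a) (n + 1) x. *)
- exists (16 + a), d.+1 => n /=.
  have := IH n; have : 0 < n.+1 ^ d by rewrite expn_gt0.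
  by rewrite expnS; set x := n.+1 ^ d; move: (cost n c) => y; nia.
Qed.

(** The cost depends on n alone and its bound is monotone, so m can later be the number of edges,
    which makes the argument of q the graph size. *)
Lemma compile_polynomial c e : exists q : {poly nat}, forall n m,
  cost n c + size (compile_expr 0 e) <= (q.[n + m])%R.
Proof.
have [a [d bound]] := cost_bound c; set k := size _.
exists (a%:P * ('X + 1%:P) ^+ d + k%:P)%R => n m.
rewrite !(hornerD, hornerM, horner_exp, hornerX, hornerC) !(natrDE, natrME, natrXE).
rewrite leq_add2r (leq_trans (bound n)) // leq_mul2l addn1.
by case: d {bound} => [|d]; rewrite ?orbT // leq_exp2r ?ltnS ?leq_addr ?orbT.
Qed.

(** * Annihilation and fractional independence *)

Section Annihilation.

Variables (V : finType) (G : sgraph V).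

Lemma deg_sum x : deg G x = \sum_(y | adj G x y) 1.
Proof. by rewrite sum1_card /deg; apply: eq_card => y; rewrite inE. Qed.

Lemma deg_lt x : deg G x < #|V|.
Proof.
rewrite /deg -cardsT; apply: proper_card; rewrite properT.
by apply/eqP=> /setP/(_ x); rewrite !inE adj_irr.
Qed.

Lemma handshake : \sum_x deg G x = 2 * #|edges G|.
Proof.
pose arcs := [set e : V * V | adj G e.1 e.2].
have arcsE u v : ((u, v) \in arcs) = adj G u v by rewrite inE.
have -> : \sum_x deg G x = \sum_(e in arcs) 1.
  rewrite (eq_bigr _ (fun x _ => deg_sum x)) pair_big_dep.
  by apply: eq_bigl => -[x y]; rewrite inE.
have -> : edges G = [set [set e.1; e.2] | e in arcs].
  by apply: eq_imset => e; rewrite ?inE.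
rewrite (partition_big_imset (fun e => [set e.1; e.2])) /=.
rewrite mulnC -sum_nat_const; apply: eq_bigr => _ /imsetP[[x y] xy ->] /=.
rewrite inE /= in xy.
have neq_xy : x != y by apply: contraTneq xy => ->; rewrite adj_irr.
rewrite sum1_card -(_ : #|[set (x, y); (y, x)]| = 2); last first.
  by rewrite cards2 xpair_eqE negb_and neq_xy.
apply: eq_card => -[u v]; rewrite !in_set2 -topredE /= arcsE; apply/andP/orP.
  case=> uv /eqP/setP E.
  have := E u; have := E v; rewrite !inE !eqxx ?orbT /=.
  have neq_uv : u != v by apply: contraTneq uv => ->; rewrite adj_irr.
  move=> /esym/orP[/eqP Ev|/eqP Ev] /esym/orP[/eqP Eu|/eqP Eu]; subst u v.
  - by rewrite eqxx in neq_uv.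
  - by right.
  - by left.
  - by rewrite eqxx in neq_uv.
case=> /eqP[-> ->]; first by rewrite xy eqxx.
by rewrite adj_sym xy setUC eqxx.
Qed.

Lemma sumn_degree_sequence (f : nat -> nat) :
  sumn [seq f d | d <- degree_sequence G] = \sum_x f (deg G x).
Proof.
rewrite sumnE big_map (perm_big _ (permEl (perm_sort _ _))) /= big_map.
by rewrite big_enum.
Qed.

Lemma size_degree_sequence : size (degree_sequence G) = #|V|.
Proof. by rewrite size_sort size_map -cardE. Qed.

(* The sum of the k smallest degrees is the maximum over t of
   k t - \sum_x max(t - deg x, 0), attained when t is the k-th degree. *)
Lemma annihilating_leq k : k <= #|V| ->
  (sumn (take k (degree_sequence G)) <= #|edges G|) =
  [forall t : 'I_#|V|, k * t <= #|edges G| + \sum_x (t - deg G x)].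
Proof.
set s := degree_sequence G; set m := #|edges G| => lek.
have sz : size s = #|V| := size_degree_sequence.
have sub t : \sum_x (t - deg G x) = sumn [seq t - d | d <- s].
  by rewrite (sumn_degree_sequence (subn t)).
(* Entrywise t <= d + max(t - d, 0), with equality when d <= t; [upper] is the case of equality. *)
have lower t r : size r * t <= sumn r + sumn [seq t - d | d <- r].
  by elim: r => //= d r; lia.
have upper t r : all (fun d => d <= t) r -> size r * t = sumn r + sumn [seq t - d | d <- r].
  by elim: r => //= d r IH /andP[led /IH]; lia.
apply/idP/forallP => [les t|H].
  rewrite sub; have := lower t (take k s); rewrite size_takel ?sz // => ltk.
  apply: leq_trans ltk _; apply: leq_add les _.
  by rewrite -{2}(cat_take_drop k s) map_cat sumn_cat leq_addr.
case: k lek H => [|k] ltk H; first by rewrite take0.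
(* The critical level is the last degree taken, k now being one less than the number of terms: the
   terms taken are at most t, and the others have no deficit. Degrees are below #|V|, which is why
   the levels below #|V| suffice. *)
pose t := nth 0 s k.
have lttV : t < #|V|.
  have : t \in s by rewrite mem_nth ?sz.
  by rewrite mem_sort => /mapP[x _ ->]; apply: deg_lt.
have srt : sorted leq s by apply: sort_sorted; apply: leq_total.
have mono i j : i <= j -> j < size s -> nth 0 s i <= nth 0 s j.
  by move=> leij ltj; apply: (sorted_leq_nth leq_trans leqnn) => //; rewrite inE; lia.
have all1 : all (fun d => d <= t) (take k.+1 s).
  apply/(all_nthP 0) => i; rewrite size_takel ?sz // => lti.
  by rewrite nth_take // mono ?sz.
have all2 : sumn [seq t - d | d <- drop k.+1 s] = 0.
  rewrite sumnE big_map big1_seq // => d /andP[_ /(nthP 0)[i]].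
  rewrite size_drop => lti <-; rewrite nth_drop.
  apply/eqP; rewrite subn_eq0; apply: mono; last by rewrite -ltn_subRL.
  by rewrite ltnW // ltnS leq_addr.
have := H (Ordinal lttV); rewrite /= sub -{1}(cat_take_drop k.+1 s) map_cat sumn_cat.
rewrite all2 addn0; have := upper t _ all1; rewrite size_takel ?sz //.
by lia.
Qed.

(* x |-> y x / 2 is a fractional independent set. *)
Lemma fractional_independent_annihilation (y : V -> nat) :
  (forall x, y x <= 2) -> (forall u v, adj G u v -> y u + y v <= 2) ->
  \sum_x y x <= 2 * annihilation_number G + 1.
Proof.
move=> y2 yadj; rewrite leqNgt; apply/negP => gt.
set a := annihilation_number G in gt.
have leV : \sum_x y x <= 2 * #|V|.
  by rewrite mulnC -sum_nat_const; apply: leq_sum.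
(* The sum runs over arcs (x, z) with weight y x; reversing the arcs gives weight y z. Added
   together, each of the 2m arcs carries y x + y z <= 2. *)
have yd : \sum_x y x * deg G x <= 2 * #|edges G|.
  rewrite -(leq_pmul2l (isT : 0 < 2)) -handshake mul2n -addnn.
  have E1 : \sum_x y x * deg G x = \sum_x \sum_(z | adj G x z) y x.
    by apply: eq_bigr => x _; rewrite deg_sum big_distrr /=; apply: eq_bigr => *; rewrite muln1.
  have E2 : \sum_x y x * deg G x = \sum_x \sum_(z | adj G x z) y z.
    rewrite E1 (exchange_big_dep xpredT) //=; apply: eq_bigr => x _.
    by apply: eq_bigl => z; rewrite adj_sym.
  rewrite {1}E1 E2 -big_split big_distrr /=; apply: leq_sum => x _.
  rewrite -big_split deg_sum big_distrr /=; apply: leq_sum => z xz.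
  by rewrite muln1 yadj.
have ltaV : a.+1 <= #|V| by lia.
suff : a.+1 <= a by rewrite ltnn.
apply: (leq_bigmax_seq (F := id)); first by rewrite mem_index_iota.
rewrite annihilating_leq //; apply/forallP => t.
(* For each x, y x * t <= y x * deg x + 2 * max(t - deg x, 0), because y x <= 2. Summed up, a + 1
   passes the test at level t, against the maximality of a. *)
rewrite -(leq_pmul2l (isT : 0 < 2)) mulnDr.
have : (\sum_x y x) * t <= \sum_x y x * deg G x + 2 * \sum_x (t - deg G x).
  rewrite big_distrl big_distrr -big_split /=; apply: leq_sum => x _.
  by have := y2 x; nia.
have : 2 * (a.+1 * t) <= (\sum_x y x) * t by rewrite mulnA leq_mul2r; lia.
lia.
Qed.

End Annihilation.

(** * Matchings in the bipartite double cover *)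

Section Auction.

Variables (V : finType) (G : sgraph V).

(* A matching of the bipartite double cover of G: partner j = Some i when the
   second copy of j is matched to the first copy of i. *)
Definition matching (partner : V -> option V) : Prop :=
  (forall i j, partner j = Some i -> adj G i j) /\
  (forall i j k, partner j = Some i -> partner k = Some i -> j = k).

Definition assigned (partner : V -> option V) (i : V) : bool :=
  [exists j, partner j == Some i].

Definition matching_size (partner : V -> option V) : nat :=
  #|[set j | partner j]|.

(* The last clause is complementary slackness up to 1: each vertex is assigned
   a cheapest neighbour, up to the last increment. *)
Definition auction (partner : V -> option V) (price : V -> nat) : Prop :=
  [/\ matching partner,
      forall j, price j <= #|V|,
      forall j, partner j = None -> price j = 0
    & forall i j k, partner j = Some i -> adj G i k -> price j <= (price k).+1].

Definition with_value (T : Type) (f : V -> T) (x : V) (v : T) : V -> T :=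
  fun y => if y == x then v else f y.

(** A previous holder of j is displaced and becomes unassigned, but j itself stays matched, so
    unmatched copies still have price 0. As j was a cheapest neighbour of i, raising its price by
    one respects the slackness, and a higher price of j cannot harm the other assigned vertices. *)
Lemma auction_bid partner price i j :
  auction partner price -> ~~ assigned partner i -> adj G i j ->
  (forall k, adj G i k -> price j <= price k) -> price j < #|V| ->
  auction (with_value partner j (Some i)) (with_value price j (price j).+1).
Proof.
case=> -[Hadj Hinj] Hle H0 Hcs /existsPn free ij min lt.
rewrite /with_value; split; [split| | |].
- by move=> i' j'; case: eqP => [-> [<-]|_ /Hadj].
- move=> i' j' k; case: eqP => [-> [<-]|_ Ej]; case: eqP => [-> Ek //|_ Ek].
  + by have := free k; rewrite Ek eqxx.
  + by case: Ek => Ei; have := free j'; rewrite Ej Ei eqxx.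
  + exact: Hinj Ej Ek.
- by move=> k; case: eqP.
- by move=> k; case: eqP => // _ /H0.
- move=> i' j' k; case: (j' =P j) => [_ [<-] ik|_ Ej' ik].
    by rewrite ltnS; case: eqP => // _; exact: min.
  case: eqP => [Ek|_]; last exact: Hcs ik.
  by rewrite (leq_trans (Hcs _ _ _ Ej' ik)) // Ek.
Qed.

Lemma matching_size_inj partner (A : {set V}) :
  matching partner -> (forall i, i \in A -> assigned partner i) ->
  #|A| <= #|[set j | if partner j is Some i then i \in A else false]|.
Proof.
move=> [_ Hinj] sat; set B := [set j | _].
have sub : A \subset [set odflt j (partner j) | j in B].
  apply/subsetP=> i iA; have /existsP[j /eqP Ej] := sat i iA.
  by apply/imsetP; exists j; rewrite ?inE Ej.
by apply: leq_trans (subset_leq_card sub) (leq_imset_card _ _).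
Qed.

(* Some price level in [1, #|V|] is unused when a vertex is unassigned; the
   vertices above that level together with the partners of those below it form
   a vertex cover of the double cover of size matching_size partner. *)
Lemma auction_dual partner price :
  auction partner price ->
  (forall i j, ~~ assigned partner i -> adj G i j -> #|V| <= price j) ->
  exists y : V -> nat, [/\ forall x, y x <= 2,
    forall u v, adj G u v -> y u + y v <= 2
    & 2 * #|V| <= \sum_x y x + matching_size partner].
Proof.
case=> Hm Hle H0 Hcs stable; have [Hadj Hinj] := Hm.
(* If every vertex is assigned, the level #|V| + 1 lies above all prices. Otherwise the positive
   prices sit on matched copies, of which an unassigned [i0] leaves at most #|V| - 1, so they cannot
   fill all the levels from 1 to #|V|. *)
have [l [l_gt0 l_free l_stable]] : exists l, [/\ 0 < l, forall j, price j != l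
    & forall i j, ~~ assigned partner i -> adj G i j -> l <= price j].
  have [all_assigned|] := boolP [forall i, assigned partner i].
    exists #|V|.+1; split=> // [j|i j /negP[]]; last exact/forallP.
    by rewrite neq_ltn ltnS Hle.
  rewrite negb_forall => /existsP[i0 i0_free].
  have : ~~ [forall l : 'I_#|V|, [exists j, price j == l.+1]].
    apply/negP=> /forallP levels.
    have sub : {subset iota 1 #|V| <= [seq price j | j in [set j | partner j]]}.
      move=> l; rewrite mem_iota add1n ltnS => /andP[l_gt0 lel].
      have ltl : l.-1 < #|V| by rewrite prednK.
      have /existsP[j /eqP Ej] := levels (Ordinal ltl).
      rewrite /= prednK // in Ej; rewrite -Ej; apply: image_f.
      by rewrite inE; case Ep: (partner j) => //; rewrite -Ej H0 in l_gt0.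
    have := uniq_leq_size (iota_uniq _ _) sub.
    rewrite size_iota size_image leqNgt => /negP[].
    have sub2 : [set odflt i0 (partner j) | j in [set j | partner j]] \subset [set~ i0].
      apply/subsetP=> i /imsetP[j]; rewrite !inE; case Ep: (partner j) => [k|] // _ ->.
      by apply: contraNneq i0_free => <-; apply/existsP; exists j; rewrite Ep.
    have := subset_leq_card sub2; rewrite cardsC1 card_in_imset => [le|j k].
      by apply: leq_ltn_trans le _; rewrite ltn_predL; apply/card_gt0P; exists i0.
    rewrite !inE; case Ej: (partner j) => [i|] //; case Ek: (partner k) => [i'|] // _ _ /= Ei.
    by apply: Hinj Ej _; rewrite Ek Ei.
  rewrite negb_forall => /existsP[l]; rewrite negb_exists => /forallP l_free.
  exists l.+1; split=> // i j i_free ij.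
  by rewrite (leq_trans _ (stable i j i_free ij)).
pose upper := [set j | l <= price j].
pose lower := [set i | [exists j, (partner j == Some i) && (price j < l)]].
have cover u v : adj G u v -> (u \in lower) || (v \in upper).
  move=> uv; rewrite !inE orbC; case: leqP => //= lt.
  have [/existsP[j /eqP Ej]|u_free] := boolP (assigned partner u); last first.
    by have := l_stable u v u_free uv; rewrite leqNgt lt.
  apply/existsP; exists j; rewrite Ej eqxx /=.
  by rewrite ltn_neqAle l_free (leq_trans (Hcs _ _ _ Ej uv)).
(* The number of copies of x left out of the cover. An edge uv is covered in both orientations, so
   at most two of the four copies of u and v are left out. *)
exists (fun x => (x \notin lower) + (x \notin upper)); split=> [x|u v uv|].
- by case: (_ \in _); case: (_ \in _).
- have := cover u v uv; have := cover v u; rewrite adj_sym => /(_ uv).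
  by do 4!case: (_ \in _).
- have countC (A : {set V}) : \sum_x (x \notin A) = #|V| - #|A|.
    rewrite -(cardsC A) addKn -sum1_card [RHS]big_mkcond; apply: eq_bigr => x _.
    by rewrite inE; case: (x \in A).
  rewrite big_split /= !countC.
  (* Passing from [lower] to its partners embeds it among the matched second copies, disjointly from
     [upper]; hence the cover has at most [matching_size partner] elements. *)
  pose lower' := [set j | if partner j is Some i then i \in lower else false].
  have le_lower : #|lower| <= #|lower'|.
    apply: matching_size_inj Hm _ => i; rewrite inE => /existsP[j /andP[Ej _]].
    by apply/existsP; exists j.
  have disj : lower' :&: upper = set0.
    apply/setP=> j; rewrite !inE; case Ej: (partner j) => [i|] //.
    rewrite inE; apply/negP=> /andP[/existsP[k /andP[/eqP Ek ltk]]].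
    by rewrite (Hinj _ _ _ Ej Ek) leqNgt ltk.
  have sub : lower' :|: upper \subset [set j | partner j].
    apply/subsetP=> j; rewrite !inE; case Ej: (partner j) => //=.
    by rewrite (H0 _ Ej) leqNgt l_gt0.
  have := subset_leq_card sub; rewrite cardsU disj cards0 subn0 -/(matching_size _).
  move: le_lower (max_card lower) (max_card upper).
  move: #|lower'| #|lower| #|upper| #|V| (matching_size _) => a b c d e.
  by lia.
Qed.

End Auction.

(** * Vertex covers and 2-SAT *)

Section Covers.

Variables (V : finType) (G : sgraph V).

Definition cover (C : {set V}) : Prop :=
  forall u v, adj G u v -> (u \in C) || (v \in C).

(* W x = Some z stands for the clause "not both x and z in C". *)
Definition violated (W : V -> option V) (C : {set V}) (x : V) : bool :=
  if W x is Some z then (x \in C) && (z \in C) else false.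

(** An unmatched second copy j gives the degenerate clause on j and j, which forbids j in C.
    Together with [unassigned_clauses], which does the same for first copies, this indexes by
    vertices all the items that v counts. *)
Definition matched_clauses (partner : V -> option V) (j : V) : option V :=
  Some (odflt j (partner j)).

Definition unassigned_clauses (partner : V -> option V) (i : V) : option V :=
  if assigned partner i then None else Some i.

Definition satisfiable (W0 W1 : V -> option V) : Prop :=
  exists C, [/\ cover C, forall x, ~~ violated W0 C x
    & forall x, ~~ violated W1 C x].

Lemma independent_setC (S : {set V}) : independent G S -> cover (~: S).
Proof.
move=> /forall_inP HS u v uv; rewrite !inE -negb_and; apply/negP=> /andP[uS vS].
by have /forall_inP/(_ v vS) := HS u uS; rewrite uv.
Qed.

Lemma cover_setC (C : {set V}) : cover C -> independent G (~: C).
Proof.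
move=> HC; apply/forall_inP=> u uC; apply/forall_inP=> v vC.
by apply/negP=> /HC; move: uC vC; rewrite !inE => /negPf-> /negPf->.
Qed.

(** Count C once through the first copies and once through the second ones. A matched pair ij
    contributes (i \in C) + (j \in C), which is 1 plus its violation because C covers the edge; an
    unmatched copy contributes exactly its violation. *)
Lemma cover_card partner C : matching G partner -> cover C ->
  2 * #|C| = matching_size partner +
    (\sum_x violated (matched_clauses partner) C x +
     \sum_x violated (unassigned_clauses partner) C x).
Proof.
move=> [Hadj Hinj] HC.
have C1 : #|C| = \sum_j (j \in C).
  by rewrite -sum1_card big_mkcond; apply: eq_bigr => j _; case: (_ \in _).
pose f (j : V) : nat := if partner j is Some i then i \in C else 0.
have C2 : #|C| = \sum_j f j + \sum_i violated (unassigned_clauses partner) C i.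
  have -> : \sum_j f j = \sum_i assigned partner i * (i \in C).
    rewrite (bigID (fun j => isSome (partner j))) /= [X in _ + X]big1 ?addn0; last first.
      by move=> j; rewrite /f; case: (partner j).
    transitivity (\sum_(j | partner j) \sum_(i | partner j == Some i) (i \in C)).
      apply: eq_bigr => j; rewrite /f; case: (partner j) => // i _.
      by rewrite (big_pred1 i) // => k; rewrite eq_sym; apply/eqP/eqP => [[]|->].
    rewrite (exchange_big_dep xpredT) //=; apply: eq_bigr => i _.
    rewrite sum_nat_const; congr (_ * _).
    case: (boolP (assigned _ _)) => [/existsP[j Ej]|/existsPn Ei].
      rewrite /= -(card1 j); apply: eq_card => k; rewrite !inE -topredE /=.
      apply/andP/eqP => [[_ /eqP Ek]|->]; first by apply: Hinj Ek _; apply/eqP.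
      by rewrite Ej (eqP Ej).
    by rewrite /=; apply: eq_card0 => k; rewrite -topredE /= (negPf (Ei k)) andbF.
  rewrite C1 -big_split /=; apply: eq_bigr => i _.
  rewrite /violated /unassigned_clauses.
  by case: (assigned _ _) => /=; rewrite ?mul1n ?addn0 ?mul0n ?add0n ?andbb.
rewrite mul2n -addnn {1}C1 C2 addnA addnA; congr (_ + _).
rewrite /matching_size -sum1_card [\sum_(i in _) _]big_mkcond -!big_split /=.
apply: eq_bigr => j _; rewrite inE /f /violated /matched_clauses.
case Ej: (partner j) => [i|] /=; last by rewrite andbb addn0 add0n.
by have := HC i j (Hadj _ _ Ej); case: (i \in C); case: (j \in C).
Qed.

Lemma violated_erase W C t x :
  violated (with_value W t None) C x = (x != t) && violated W C x.
Proof. by rewrite /violated /with_value; case: eqP. Qed.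

Lemma sum_bool_le1 (f : pred V) : 0 < #|V| ->
  \sum_x f x <= 1 <-> exists t, forall x, x != t -> ~~ f x.
Proof.
move=> /card_gt0P[x0 _]; split=> [le1|[t Ht]]; last first.
  by rewrite (bigD1 t) //= big1 ?addn0 ?leq_b1 // => x /Ht /negPf->.
have [t ft|f0] := pickP f; last by exists x0 => x _; rewrite f0.
exists t => x xt; apply/negP => fx; move: le1.
by rewrite (bigD1 t) //= ft (bigD1 x) //= fx.
Qed.

Lemma independence_eq_annihilation partner price :
  0 < #|V| -> auction G partner price ->
  (forall i j, ~~ assigned partner i -> adj G i j -> #|V| <= price j) ->
  let W0 := matched_clauses partner in
  let W1 := unassigned_clauses partner in
  independence_number G = annihilation_number G <->
  matching_size partner + 2 * annihilation_number G <= 2 * #|V| /\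
  exists t, satisfiable (with_value W0 t None) W1 \/
            satisfiable W0 (with_value W1 t None).
Proof.
move=> V_gt0 Hauc stable W0 W1.
have Hm : matching G partner by case: Hauc.
set a := annihilation_number G.
have le_alpha S : independent G S -> #|S| <= a.
  move=> HS; have := @fractional_independent_annihilation V G (fun x => 2 * (x \in S)).
  rewrite -big_distrr /= -/a.
  have -> : \sum_x (x \in S) = #|S|.
    by rewrite -sum1_card [RHS]big_mkcond; apply: eq_bigr => x _; case: (_ \in _).
  move=> H; suff : 2 * #|S| <= 2 * a + 1 by lia.
  apply: H => [x|u v uv]; first by case: (_ \in _).
  have := independent_setC HS uv; rewrite !inE.
  by case: (u \in S); case: (v \in S).
have large : 2 * #|V| <= matching_size partner + 2 * a + 1.
  have [y [y2 yadj le]] := auction_dual Hauc stable.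
  by have := fractional_independent_annihilation y2 yadj; rewrite -/a; lia.
split=> [Ea|[small [t sat]]].
  have [I HI EI] : exists2 I, independent G I & #|I| = a.
    have : independent G set0 by apply/forall_inP=> x; rewrite inE.
    move=> H0; have H : 0 < #|[pred S | independent G S]| by apply/card_gt0P; exists set0.
    have [I HI EI] := eq_bigmax_cond (fun S : {set V} => #|S|) H.
    by exists I => //; rewrite -Ea -EI.
  have HC := independent_setC HI; have E := cover_card Hm HC.
  have cardC : #|~: I| = #|V| - a by rewrite cardsCs setCK EI.
  have leaV : a <= #|V| by rewrite -EI max_card.
  rewrite cardC in E; split; first lia.
  set v0 := \sum_x _ in E; set v1 := \sum_x _ in E.
  have sum0 (f : pred V) : \sum_x f x = 0 -> forall x, ~~ f x.
    by move/eqP; rewrite sum_nat_eq0 => /forallP H x; have := H x; rewrite /= eqb0.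
  have erase W t : (forall x, x != t -> ~~ violated W (~: I) x) ->
      forall x, ~~ violated (with_value W t None) (~: I) x.
    by move=> H x; rewrite violated_erase negb_and -implybE; apply/implyP/H.
  (* Here v0 + v1 <= 1, so at least one sum vanishes, and the other has at most one nonzero term,
     whose index is the one to exempt. *)
  have [v1_0|v1_gt0] := posnP v1.
    have /(sum_bool_le1 _ V_gt0)[t Ht] : v0 <= 1 by lia.
    exists t; left; exists (~: I); split=> //; first exact: erase.
    exact: sum0 v1_0.
  have /(sum_bool_le1 _ V_gt0)[t Ht] : v1 <= 1 by lia.
  exists t; right; exists (~: I); split=> //; last exact: erase.
  by apply: sum0; rewrite -/v0; lia.
(* Erasing one clause leaves at most that one violated, so v <= 1. With the bound on the matching,
   2|C| <= 2(n - a) + 1, and parity gives |C| <= n - a. *)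
have [C HC leC] : exists2 C, cover C & 2 * #|C| <= matching_size partner + 1.
  have unerase W C : (forall x, ~~ violated (with_value W t None) C x) ->
      \sum_x violated W C x <= 1.
    move=> H; apply/(sum_bool_le1 _ V_gt0); exists t => x xt.
    by have := H x; rewrite violated_erase xt.
  have zero W C : (forall x, ~~ violated W C x) -> \sum_x violated W C x = 0.
    by move=> H; rewrite big1 // => x _; rewrite (negPf (H x)).
  by case: sat => -[C [HC H0 H1]]; exists C => //; rewrite (cover_card Hm HC) leq_add2l;
    [rewrite (zero _ _ H1) addn0 | rewrite (zero _ _ H0) add0n]; apply: unerase.
suff : a <= independence_number G.
  move=> le; apply/eqP; rewrite eqn_leq le andbT.
  by apply/bigmax_leqP => S; apply: le_alpha.
apply: leq_trans (leq_bigmax_cond _ (cover_setC HC)).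
rewrite cardsCs setCK; have := max_card C.
by move: #|C| #|V| leC small => c n; lia.
Qed.

End Covers.

(** * Reachability and 2-SAT *)

Lemma connect_invariant (T : finType) (e : rel T) (P : T -> Prop) x y :
  (forall u v, e u v -> P u -> P v) -> connect e x y -> P x -> P y.
Proof.
move=> step /connectP[p + ->]; elim: p x => //= z p IH x /andP[xz zp] Px.
exact: IH zp (step _ _ xz Px).
Qed.

Section Ball.

Variables (T : finType) (e : rel T) (x : T).

Fixpoint ball (k : nat) : {set T} :=
  if k is k'.+1 then ball k' :|: [set z | [exists y in ball k', e y z]]
  else [set x].

Lemma ball_sub k l : k <= l -> ball k \subset ball l.
Proof.
move/subnK <-; elim: (l - k) => // d IH.
by rewrite addSn; apply: subset_trans IH (subsetUl _ _).
Qed.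

Lemma ball_connect y : connect e x y -> y \in ball #|T|.
Proof.
move=> /connectP[p xp ->]; case/shortenP: xp => q xq uq _.
have : size q <= #|T| by have := max_card (mem (x :: q)); rewrite (card_uniqP uq) => /ltnW.
move/ball_sub/subsetP; apply.
elim/last_ind: q xq {uq} => [_|q z IH]; first by rewrite inE.
rewrite rcons_path last_rcons size_rcons => /andP[/IH qb qz] /=.
by rewrite !inE; apply/orP; right; apply/exists_inP; exists (last x q).
Qed.

End Ball.

Section TwoSat.

Variable V : finType.

Definition negate (x : V * bool) : V * bool := (x.1, ~~ x.2).

Definition holds (C : {set V}) (x : V * bool) : bool := (x.1 \in C) == x.2.

Lemma negateK : involutive negate.
Proof. by case=> v b; rewrite /negate negbK. Qed.

(* A maximal closed and consistent set of literals is a total assignment. *)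
Lemma two_sat (imp : rel (V * bool)) :
  (forall x y, imp x y -> imp (negate y) (negate x)) ->
  (exists C, forall x y, imp x y -> holds C x -> holds C y) <->
  (forall v, ~~ (connect imp (v, true) (v, false) &&
                 connect imp (v, false) (v, true))).
Proof.
move=> contra; split=> [[C HC] v|Hbad].
  apply/negP=> /andP[c1 c2].
  have := connect_invariant HC c1; have := connect_invariant HC c2.
  by rewrite /holds /=; case: (v \in C) => // H1 H2; [have := H2 isT | have := H1 isT].
have connect_contra x y : connect imp x y -> connect imp (negate y) (negate x).
  move=> xy.
  have back u v : imp u v -> connect imp (negate u) (negate x) ->
      connect imp (negate v) (negate x).
    by move=> uv; apply: connect_trans; apply/connect1/contra.
  exact: (connect_invariant back xy (connect0 _ _)).
pose good (S : {set V * bool}) :=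
  [forall x in S, (negate x \notin S) && [forall y, imp x y ==> (y \in S)]].
have [S /maxsetP[Sgood Smax]] : {S | maxset good S}.
  by apply: ex_maxset; exists set0; apply/forall_inP=> x; rewrite inE.
have Sneg x : x \in S -> negate x \notin S by move=> xS; have /andP[] := forall_inP Sgood x xS.
have Simp x y : imp x y -> x \in S -> y \in S.
  by move=> xy xS; have /andP[_ /forallP/(_ y)/implyP->] := forall_inP Sgood x xS.
have total v : ((v, true) \in S) || ((v, false) \in S).
  apply/negPn/negP; rewrite negb_or => /andP[v1 v0].
  have [x [xv xS nxS Hx]] : exists x, [/\ x.1 = v, x \notin S, negate x \notin S
      & ~~ connect imp x (negate x)].
    by have := Hbad v; rewrite negb_and => /orP[H|H];
      [exists (v, true) | exists (v, false)].
  pose S' := S :|: [set y | connect imp x y].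
  have : S' = S.
    apply: Smax; last exact: subsetUl.
    apply/forall_inP=> y yS'; apply/andP; split.
      (* In the two mixed cases contraposition leads from a literal of S to [negate x], so closure
         puts it in S. If x reaches both y and its negation, contraposition gives a path from x to
         [negate x]. *)
      apply/negP; move: yS'; rewrite !inE => /orP[yS|xy] /orP[nyS|xny].
      - by have := Sneg y yS; rewrite nyS.
      - have := connect_contra _ _ xny; rewrite negateK => /(connect_invariant Simp)/(_ yS).
        by rewrite (negPf nxS).
      - have := connect_invariant Simp (connect_contra _ _ xy) nyS.
        by rewrite (negPf nxS).
      - have := connect_contra _ _ xny; rewrite negateK => H.
        by rewrite (connect_trans xy H) in Hx.
    apply/forallP=> z; apply/implyP=> yz; move: yS'; rewrite !inE.
    by case/orP=> [/(Simp _ _ yz)->//|xy]; rewrite (connect_trans xy (connect1 yz)) orbT.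
  by move/setP/(_ x); rewrite !inE connect0 orbT (negPf xS).
exists [set v | (v, true) \in S].
have holdsE x : holds [set v | (v, true) \in S] x = (x \in S).
  case: x => v [] /=; rewrite /holds /= inE; first by rewrite eqb_id.
  rewrite eqbF_neg; have := total v; have := Sneg (v, true); rewrite /negate /=.
  by case: (_ \in S) => [/(_ isT)/negPf->|_ /= ->].
by move=> x y; rewrite !holdsE; apply: Simp.
Qed.

Variables (G : sgraph V) (W0 W1 : V -> option V).

(** Symmetrised, because a clause on two vertices yields two implications, one the contrapositive of
    the other; [two_sat] needs the relation closed under contraposition. *)
Definition linked (u v : V) : bool :=
  [|| W0 u == Some v, W0 v == Some u, W1 u == Some v | W1 v == Some u].

(** The literal (x, true) means x \in C. Clauses lead from positive to negative literals, and
    covered edges from negative to positive ones. *)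
Definition implication : rel (V * bool) := fun x y =>
  if x.2 then ~~ y.2 && linked x.1 y.1 else y.2 && adj G x.1 y.1.

Lemma satisfiable_connect :
  satisfiable G W0 W1 <->
  forall v, ~~ (connect implication (v, true) (v, false) &&
                connect implication (v, false) (v, true)).
Proof.
rewrite -two_sat; last first.
  move=> [u b] [v c]; rewrite /implication /=; case: b; case: c => //=.
    by rewrite /linked orbCA [(W1 u == _) || _]orbC.
  by rewrite adj_sym.
split=> [[C [HC H0 H1]]|[C HC]]; exists C.
  move=> [u b] [v c]; rewrite /implication /holds /=; case: b; case: c => //=.
    rewrite eqb_id eqbF_neg => link uC; apply/negP => vC; move: link.
    have nv W x z : (forall x, ~~ violated W C x) -> x \in C -> z \in C -> (W x == Some z) = false.
      by move=> H xC zC; apply/eqP=> E; have := H x; rewrite /violated E xC zC.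
    by rewrite /linked !nv.
  by rewrite eqb_id eqbF_neg => /HC/orP[->|].
split=> [u v uv|x|x].
- have := HC (u, false) (v, true); rewrite /implication /holds /= uv eqb_id eqbF_neg.
  by move=> /(_ isT); case: (u \in C) => //= ->.
- rewrite /violated; case E: (W0 x) => [z|] //; apply/negP=> /andP[xC zC].
  have := HC (x, true) (z, false); rewrite /implication /holds /= /linked E eqxx xC zC /=.
  by move/(_ isT isT).
- rewrite /violated; case E: (W1 x) => [z|] //; apply/negP=> /andP[xC zC].
  have := HC (x, true) (z, false); rewrite /implication /holds /= /linked E eqxx !orbT xC zC /=.
  by move/(_ isT isT).
Qed.

End TwoSat.

(** * The decision procedure *)

(* A scalar variable is cell 0 of an array. *)
Definition var (A : nat) : expr := Get A (Cst 0).
Definition le_expr (e1 e2 : expr) : expr := Sub (Cst 1) (Sub e1 e2).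
Definition eq_expr (e1 e2 : expr) : expr :=
  Sub (Cst 1) (Add (Sub e1 e2) (Sub e2 e1)).
Definition succ_expr (e : expr) : expr := Add e (Cst 1).
Definition assign (A : nat) (e : expr) : cmd := Put A (Cst 0) e.
Definition when (e : expr) (c : cmd) : cmd := If e c Skip.

Declare Scope cmd_scope.
Local Notation "c1 ;; c2" := (Seq c1 c2) (at level 90, right associativity) : cmd_scope.
Local Notation "A ::= e" := (assign A e) (at level 80) : cmd_scope.
Local Open Scope cmd_scope.

Local Notation vROW := 0 (only parsing).
Local Notation vTMP := 1 (only parsing).
Local Notation vI := 2 (only parsing).
Local Notation vJ := 3 (only parsing).
Local Notation vDEG := 4 (only parsing).
Local Notation vTOT := 5 (only parsing).
Local Notation vK := 6 (only parsing).
Local Notation vLEVEL := 7 (only parsing).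
Local Notation vQ := 8 (only parsing).
Local Notation vKT := 9 (only parsing).
Local Notation vOK := 10 (only parsing).
Local Notation vANN := 11 (only parsing).
Local Notation vPARTNER := 12 (only parsing).
Local Notation vPRICE := 13 (only parsing).
Local Notation vBEST := 14 (only parsing).
Local Notation vARG := 15 (only parsing).
Local Notation vBUSY := 16 (only parsing).
Local Notation vCOUNT := 17 (only parsing).
Local Notation vW0 := 18 (only parsing).
Local Notation vW1 := 19 (only parsing).
Local Notation vTRUE := 20 (only parsing).
Local Notation vFALSE := 21 (only parsing).
Local Notation vASSIGNED := 22 (only parsing).
Local Notation vSAVE := 23 (only parsing).
Local Notation vHIT := 24 (only parsing).
Local Notation vBAD := 25 (only parsing).
Local Notation vANS := 26 (only parsing).
Local Notation vR := 27 (only parsing).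
Local Notation vR' := 28 (only parsing).
Local Notation vS := 29 (only parsing).
Local Notation vT := 30 (only parsing).

Definition order_expr : expr := Inp (Cst 0).
Definition adj_expr (u v : expr) : expr := Inp (Add (Get vROW u) v).

(** The machine cannot multiply, so the row offsets 1 + u * n are tabulated by repeated addition;
    the 1 skips the input cell that holds n. *)
Definition index_rows : cmd :=
  vTMP ::= Cst 1 ;;
  For vI (Put vROW (var vI) (var vTMP) ;; vTMP ::= Add (var vTMP) order_expr).

Definition degree_row : cmd :=
  For vJ (when (adj_expr (var vI) (var vJ))
    (Put vDEG (var vI) (succ_expr (Get vDEG (var vI))) ;;
     vTOT ::= succ_expr (var vTOT))).

Definition degrees : cmd := For vI degree_row.

Definition add_deficits : cmd :=
  let d := Sub (var vLEVEL) (Get vDEG (var vI)) in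
  For vI (vQ ::= Add (var vQ) (Add d d)).

(* Tests k t <= m + \sum_x max(t - deg x, 0), with both sides doubled, for
   k = vK + 1 and t = vLEVEL; vTOT is 2m. *)
Definition test_levels : cmd :=
  For vLEVEL
    (vQ ::= var vTOT ;;
     add_deficits ;;
     when (Sub (Add (var vKT) (var vKT)) (var vQ)) (vOK ::= Cst 0) ;;
     vKT ::= Add (var vKT) (succ_expr (var vK))).

Definition annihilate : cmd :=
  For vK
    (vKT ::= Cst 0 ;;
     vOK ::= Cst 1 ;;
     test_levels ;;
     when (var vOK) (vANN ::= succ_expr (var vK))).

(* vPARTNER, vW0 and vW1 hold 0 for None and x + 1 for Some x. *)
Definition scan : cmd :=
  For vJ
    (when (eq_expr (Get vPARTNER (var vJ)) (succ_expr (var vI))) (vBUSY ::= Cst 1) ;;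
     when (adj_expr (var vI) (var vJ))
       (when (Sub (var vBEST) (Get vPRICE (var vJ)))
          (vBEST ::= Get vPRICE (var vJ) ;; vARG ::= var vJ))).

Definition bid : cmd :=
  vBUSY ::= Cst 0 ;;
  vBEST ::= order_expr ;;
  scan ;;
  If (var vBUSY) Skip
    (when (Sub order_expr (var vBEST))
       (Put vPARTNER (var vARG) (succ_expr (var vI)) ;;
        Put vPRICE (var vARG) (succ_expr (var vBEST)))).

(* Unless all bidders are settled, a round raises the sum of the prices, and no
   price exceeds n: hence n * n rounds suffice. *)
Definition bidding_rounds : cmd := For vR (For vR' (For vI bid)).

Definition make_matched_clauses : cmd :=
  For vJ
    (If (Get vPARTNER (var vJ))
       (Put vW0 (var vJ) (Get vPARTNER (var vJ)) ;;
        Put vASSIGNED (Sub (Get vPARTNER (var vJ)) (Cst 1)) (Cst 1) ;;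
        vCOUNT ::= succ_expr (var vCOUNT))
       (Put vW0 (var vJ) (succ_expr (var vJ)))).

Definition make_unassigned_clauses : cmd :=
  For vJ
    (If (Get vASSIGNED (var vJ)) (Put vW1 (var vJ) (Cst 0))
       (Put vW1 (var vJ) (succ_expr (var vJ)))).

(* vTRUE and vFALSE hold the literals x \in C and x \notin C reached so far. *)
Definition propagate_edges : cmd :=
  For vI (For vJ
    (when (adj_expr (var vI) (var vJ))
       (when (Get vFALSE (var vI)) (Put vTRUE (var vJ) (Cst 1))))).

Definition propagate_clauses (W : nat) : cmd :=
  let z := Sub (Get W (var vJ)) (Cst 1) in
  For vJ
    (when (Get W (var vJ))
       (when (Get vTRUE (var vJ)) (Put vFALSE z (Cst 1)) ;;
        when (Get vTRUE z) (Put vFALSE (var vJ) (Cst 1)))).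

Definition propagate : cmd :=
  propagate_edges ;; propagate_clauses vW0 ;; propagate_clauses vW1.

Definition clear_literals : cmd :=
  For vJ (Put vTRUE (var vJ) (Cst 0) ;; Put vFALSE (var vJ) (Cst 0)).

(* There are 2n literals, hence two propagations for each value of vR. *)
Definition probe (b : bool) : cmd :=
  clear_literals ;;
  Put (if b then vTRUE else vFALSE) (var vS) (Cst 1) ;;
  For vR (propagate ;; propagate).

(** The first answer is saved in [vHIT] because the second probe clears both literal arrays. *)
Definition test_variables : cmd :=
  For vS
    (probe true ;;
     vHIT ::= Get vFALSE (var vS) ;;
     probe false ;;
     when (var vHIT) (when (Get vTRUE (var vS)) (vBAD ::= Cst 1))).

Definition two_sat_test : cmd :=
  vBAD ::= Cst 0 ;; test_variables ;; If (var vBAD) Skip (vANS ::= Cst 1).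

(** The clause with index [vT] is switched off for one test and then restored; [vANS] is never
    reset, so it accumulates the disjunction of all the tests. *)
Definition exempt (W : nat) : cmd :=
  vSAVE ::= Get W (var vT) ;;
  Put W (var vT) (Cst 0) ;;
  two_sat_test ;;
  Put W (var vT) (var vSAVE).

Definition search : cmd := For vT (exempt vW0 ;; exempt vW1).

Definition decide : cmd :=
  index_rows ;; degrees ;; annihilate ;; bidding_rounds ;;
  make_matched_clauses ;; make_unassigned_clauses ;; search.

(** Two bits added, minus 1 with truncation, form a conjunction: some exemption made the clauses
    satisfiable, and |M| + 2a <= 2n. *)
Definition verdict : expr :=
  Sub (Add (le_expr (Cst 1) (var vANS))
           (le_expr (Add (var vCOUNT) (Add (var vANN) (var vANN)))
                    (Add order_expr order_expr)))
      (Cst 1).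

Lemma decide_ok : cmd_ok 0 decide && expr_ok 0 verdict.
Proof. by []. Qed.

(** * Frame and loop rules for verifying the program *)

Fixpoint writes (c : cmd) : seq nat :=
  match c with
  | Skip => [::]
  | Put A _ _ => [:: A]
  | Seq c1 c2 | If _ c1 c2 => writes c1 ++ writes c2
  | For A c => A :: writes c
  end.

Lemma den_frame inp c s A i : A \notin writes c -> den inp c s A i = s A i.
Proof.
elim: c s => //= [B e1 e2|c1 IH1 c2 IH2|e c1 IH1 c2 IH2|B c IH] s.
- by rewrite inE /put => /negPf ->.
- by rewrite mem_cat negb_or => /andP[H1 H2]; rewrite IH2 ?IH1.
- by rewrite mem_cat negb_or => /andP[H1 H2]; case: ifP => _; rewrite ?IH2 ?IH1.
- rewrite inE negb_or => /andP[AB Ac]; elim: (iota _ _) s => //= k r IHr s.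
  by rewrite IHr IH // /put (negPf AB).
Qed.

Section Correctness.

Variables (n : nat) (G : sgraph 'I_n).

Local Notation D := (den (encode G)).
Local Notation E := (eval (encode G)).

(** The invariant rule for loops. Each step may also assume that the arrays not written by the loop
    still agree with the initial store, so invariants need not repeat this. *)
Lemma den_For A c s (P : nat -> store -> Prop) :
  P 0 s ->
  (forall (k : 'I_n) s', (forall B i, B \notin A :: writes c -> s' B i = s B i) ->
     P k s' -> P k.+1 (D c (put s' A 0 k))) ->
  P n (D (For A c) s).
Proof.
move=> P0 step; rewrite -[D (For A c) s]/(foldl _ s (iota 0 n)).
set f := fun s k => _.
pose Q k s' := P k s' /\ forall B i, B \notin A :: writes c -> s' B i = s B i.
suff H m k s' : k + m = n -> Q k s' -> Q n (foldl f s' (iota k m)).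
  by have [] := H n 0 s (add0n n) (conj P0 (fun _ _ _ => erefl)).
elim: m k s' => [|m IH] k s' /=; first by rewrite addn0 => ->.
move=> km [Pk fr]; have ltk : k < n by rewrite -km addnS ltnS leq_addr.
apply: IH; first by rewrite addSnnS.
split; first exact: (step (Ordinal ltk)).
move=> B i; rewrite inE negb_or => /andP[BA Bc].
by rewrite -[f s' k B i]/(D c (put s' A 0 k) B i) den_frame // /put (negPf BA) fr // inE negb_or BA.
Qed.

Lemma den_Seq c1 c2 s : D (c1 ;; c2) s = D c2 (D c1 s).
Proof. by []. Qed.

Lemma den_Put A e1 e2 s : D (Put A e1 e2) s = put s A (E s e1) (E s e2).
Proof. by []. Qed.

Lemma den_assign A e s : D (A ::= e) s = put s A 0 (E s e).
Proof. by []. Qed.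

Lemma den_If e c1 c2 s : D (If e c1 c2) s = if 0 < E s e then D c1 s else D c2 s.
Proof. by []. Qed.

Lemma den_when e c s : D (when e c) s = if 0 < E s e then D c s else s.
Proof. by []. Qed.

Definition denE := (den_Seq, den_assign, den_Put, den_when, den_If).

Lemma eval_order s : E s order_expr = n.
Proof. by []. Qed.

Lemma eval_var s A : E s (var A) = s A 0.
Proof. by []. Qed.

Lemma eval_get s A e : E s (Get A e) = s A (E s e).
Proof. by [].
Qed.

Lemma eval_le s e1 e2 : E s (le_expr e1 e2) = (E s e1 <= E s e2).
Proof. by rewrite /=; lia. Qed.

Lemma eval_eq s e1 e2 : E s (eq_expr e1 e2) = (E s e1 == E s e2).
Proof. by rewrite /=; lia. Qed.

Lemma nth_allpairs (S T R : Type) (f : S -> T -> R) x0 y0 z0 r t i j :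
  i < size r -> j < size t ->
  nth z0 [seq f x y | x <- r, y <- t] (i * size t + j) = f (nth x0 r i) (nth y0 t j).
Proof.
elim: r i => //= x r IH [|i] lti ltj; rewrite nth_cat size_map.
  by rewrite mul0n ltj (nth_map y0).
by rewrite mulSn -addnA ltnNge leq_addr /= addKn IH.
Qed.

Lemma nth_encode (u v : 'I_n) : nth 0 (encode G) (1 + u * n + v) = adj G u v.
Proof.
rewrite -addnA add1n /= -[X in _ * X](size_enum_ord n).
by rewrite (nth_allpairs _ u u) ?size_enum_ord ?nth_ord_enum.
Qed.

(** * Adjacency, degrees and the annihilation number *)

Definition rows (s : store) : Prop := forall u : 'I_n, s vROW u = 1 + u * n.

Lemma eval_adj s e1 e2 (u v : 'I_n) :
  rows s -> E s e1 = u -> E s e2 = v -> E s (adj_expr e1 e2) = adj G u v.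
Proof. by move=> rs /= -> ->; rewrite rs nth_encode. Qed.

Lemma index_rows_correct (s : store) : rows (D index_rows s).
Proof.
rewrite /index_rows denE.
pose P k (s : store) := s vTMP 0 = 1 + k * n /\ forall u : 'I_n, u < k -> s vROW u = 1 + u * n.
suff [_ H] : P n (D (For vI (Put vROW (var vI) (var vTMP) ;;
    vTMP ::= Add (var vTMP) order_expr)) (D (vTMP ::= Cst 1) s)).
  by move=> u; apply: H.
apply: den_For => [|k s' _ [H1 H2]]; first by split.
rewrite !denE; split; rewrite /put /=; first lia.
by move=> u ltu; case: eqP => [->//|neq]; apply: H2; lia.
Qed.

Lemma sum_ltS (F : 'I_n -> nat) (k : 'I_n) :
  \sum_(v < n | v < k.+1) F v = \sum_(v < n | v < k) F v + F k.
Proof.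
rewrite (bigD1 k) //= addnC; congr (_ + _); apply: eq_bigl => v.
by rewrite ltnS ltn_neqAle andbC.
Qed.

Lemma sum_ltn (F : 'I_n -> nat) : \sum_(v < n | v < n) F v = \sum_v F v.
Proof. by apply: eq_bigl => v; rewrite ltn_ord. Qed.

Lemma sum_lt0 (F : 'I_n -> nat) : \sum_(v < n | v < 0) F v = 0.
Proof. by rewrite big_pred0. Qed.

Lemma forall_ltS (Q : pred 'I_n) (k : 'I_n) :
  [forall v : 'I_n, (v < k.+1) ==> Q v] =
  [forall v : 'I_n, (v < k) ==> Q v] && Q k.
Proof.
apply/forallP/andP => [H|[/forallP H Qk] v].
  split; last by have := H k; rewrite ltnSn.
  by apply/forallP=> v; apply/implyP=> lt; have := H v; rewrite ltnW.
apply/implyP; rewrite ltnS leq_eqVlt => /orP[/eqP/ord_inj->//|lt].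
by have := H v; rewrite lt.
Qed.

Lemma degree_row_correct (s : store) (i : 'I_n) :
  rows s -> s vI 0 = i ->
  let s' := D degree_row s in
  [/\ s' vDEG i = s vDEG i + deg G i, s' vTOT 0 = s vTOT 0 + deg G i
    & forall v : nat, v != i -> s' vDEG v = s vDEG v].
Proof.
move=> rs si s'; rewrite deg_sum big_mkcond /= {}/s'.
pose P k (s' : store) := [/\
  s' vDEG i = s vDEG i + \sum_(v < n | v < k) (adj G i v : nat),
  s' vTOT 0 = s vTOT 0 + \sum_(v < n | v < k) (adj G i v : nat)
  & forall v : nat, v != i -> s' vDEG v = s vDEG v].
have : P n (D degree_row s).
  apply: den_For => [|k s' fr [H1 H2 H3]]; first by split; rewrite ?sum_lt0 ?addn0.
  have Eadj : E (put s' vJ 0 k) (adj_expr (var vI) (var vJ)) = adj G i k.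
    by apply: eval_adj => [u||]; rewrite /= /put /= ?fr.
  rewrite denE Eadj.
  have si' : s' vI 0 = i by rewrite fr.
  rewrite !denE /P sum_ltS /put /= si'; case: (adj G i k) => /=; last first.
    by rewrite addn0; split.
  rewrite eqxx /= H1 H2 !addnA; split=> // v neq.
  by rewrite (negPf neq) H3.
by rewrite /P !sum_ltn; under eq_bigr do rewrite -[nat_of_bool _]/(if _ then 1 else 0).
Qed.

Lemma degrees_correct (s : store) :
  rows s -> (forall v, s vDEG v = 0) -> s vTOT 0 = 0 ->
  let s' := D degrees s in
  (forall v : 'I_n, s' vDEG v = deg G v) /\ s' vTOT 0 = 2 * #|edges G|.
Proof.
move=> rs deg0 tot0 r; rewrite -handshake.
pose P k (s' : store) := [/\ forall v : 'I_n, v < k -> s' vDEG v = deg G v,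
  forall v, k <= v -> s' vDEG v = 0
  & s' vTOT 0 = \sum_(v < n | v < k) deg G v].
suff [H1 _ H2] : P n (D degrees s).
  by split=> [v|]; [apply: H1 | rewrite [LHS]H2 sum_ltn].
apply: den_For => [|k s' fr [H1 H2 H3]]; first by split; rewrite ?sum_lt0.
have rs' : rows (put s' vI 0 k) by move=> u; rewrite /put /= fr // rs.
have [E1 E2 E3] := degree_row_correct rs' (erefl _ : put s' vI 0 k vI 0 = k).
split; last by rewrite E2 sum_ltS /put /= H3.
- move=> v; rewrite ltnS leq_eqVlt => /orP[/eqP/ord_inj->|lt].
    by rewrite E1 /put /= H2.
  by rewrite E3 ?ltn_eqF // /put /= H1.
- by move=> v lt; rewrite E3 ?gtn_eqF // /put /= H2 // ltnW.
Qed.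

Lemma add_deficits_correct (s : store) t :
  (forall v : 'I_n, s vDEG v = deg G v) -> s vLEVEL 0 = t ->
  D add_deficits s vQ 0 = s vQ 0 + 2 * \sum_(v : 'I_n) (t - deg G v).
Proof.
move=> sdeg st.
pose P k (s' : store) := s' vQ 0 = s vQ 0 + 2 * \sum_(v < n | v < k) (t - deg G v).
suff : P n (D add_deficits s) by rewrite /P sum_ltn.
apply: den_For => [|k s' fr H]; first by rewrite /P sum_lt0 muln0 addn0.
have st' : s' vLEVEL 0 = t by rewrite fr.
rewrite /P sum_ltS !denE /= /put /= H st' (fr vDEG) // sdeg.
by rewrite mulnDr mul2n -addnn mul2n -addnn -!addnA.
Qed.

Definition annihilates (k t : nat) : bool :=
  k * t <= #|edges G| + \sum_(v : 'I_n) (t - deg G v).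

Lemma annihilatesE k : k <= n ->
  (sumn (take k (degree_sequence G)) <= #|edges G|) =
  [forall t : 'I_n, annihilates k t].
Proof.
by move=> lek; rewrite annihilating_leq ?card_ord.
Qed.

Lemma test_levels_correct (s : store) (k : nat) :
  (forall v : 'I_n, s vDEG v = deg G v) -> s vTOT 0 = 2 * #|edges G| ->
  s vK 0 = k -> s vKT 0 = 0 -> s vOK 0 = 1 ->
  D test_levels s vOK 0 = [forall t : 'I_n, annihilates k.+1 t].
Proof.
move=> sdeg stot sk skt sok.
pose P t (s' : store) := s' vKT 0 = k.+1 * t /\
  s' vOK 0 = [forall u : 'I_n, (u < t) ==> annihilates k.+1 u].
suff [_ ->] : P n (D test_levels s).
  by congr nat_of_bool; apply: eq_forallb => u; rewrite ltn_ord.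
apply: den_For => [|t s' fr [H1 H2]].
  by by split; rewrite ?muln0 // sok; case: forallP => // -[].
rewrite den_Seq den_assign; set s1 := put _ vQ 0 _.
have sdeg1 (v : 'I_n) : s1 vDEG v = deg G v by rewrite /s1 /put /= fr // sdeg.
have E1 := add_deficits_correct sdeg1 (erefl _ : s1 vLEVEL 0 = t).
rewrite den_Seq; set s2 := D add_deficits s1 in E1 *.
have E2 : s2 vKT 0 = k.+1 * t by rewrite /s2 den_frame.
have E3 : s2 vK 0 = k by rewrite /s2 den_frame //= /s1 /put /= (fr vK).
have E4 : s2 vOK 0 = s' vOK 0 by rewrite /s2 den_frame.
rewrite {1}/s1 /put /= (fr vTOT) // stot in E1.
rewrite !denE /P forall_ltS /= /put /=; set b := [forall v, _] in H2 *.
have Eb : annihilates k.+1 t = (s2 vKT 0 + s2 vKT 0 - s2 vQ 0 == 0).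
  by rewrite /annihilates E1 E2 subn_eq0 addnn -mul2n -mulnDr leq_pmul2l.
rewrite Eb; case: posnP => _ /=; rewrite ?E2 ?E3 ?E4 ?H2; split; lia.
Qed.

(** The values k come in increasing order and each one that passes overwrites the last, so what
    remains is the maximum. *)
Lemma annihilate_correct (s : store) :
  (forall v : 'I_n, s vDEG v = deg G v) -> s vTOT 0 = 2 * #|edges G| ->
  s vANN 0 = 0 ->
  D annihilate s vANN 0 = annihilation_number G.
Proof.
move=> sdeg stot sann.
pose P k (s' : store) := s' vANN 0 =
  \max_(1 <= j < k.+1 | sumn (take j (degree_sequence G)) <= #|edges G|) j.
suff : P n (D annihilate s) by rewrite /P /annihilation_number card_ord.
apply: den_For => [|k s' fr H]; first by rewrite /P big_geq.
rewrite 2!den_Seq 2!den_assign den_Seq; set s1 := put _ vOK 0 _.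
have sdeg1 (v : 'I_n) : s1 vDEG v = deg G v by rewrite /s1 /put /= fr // sdeg.
have stot1 : s1 vTOT 0 = 2 * #|edges G| by rewrite /s1 /put /= fr // stot.
have Eok := test_levels_correct sdeg1 stot1 (erefl _ : s1 vK 0 = k) erefl erefl.
set s2 := D test_levels s1 in Eok *.
have Eann : s2 vANN 0 = s' vANN 0 by rewrite /s2 den_frame.
have Ek : s2 vK 0 = k by rewrite /s2 den_frame.
rewrite den_when eval_var Eok.
rewrite /P big_mkcond big_nat_recr //= -big_mkcond -H annihilatesE //.
case: forallP => _ /=; last by rewrite maxn0.
rewrite /put /= Ek addn1; apply/esym/maxn_idPr; rewrite H.
by apply/bigmax_leqP_seq => j; rewrite mem_index_iota => /andP[_ ltj] _; apply: ltnW.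
Qed.

(** * Running the auction *)

Definition code (o : option 'I_n) : nat := if o is Some i then i.+1 else 0.

Lemma code_eq (o : option 'I_n) (i : 'I_n) : (code o == i.+1) = (o == Some i).
Proof. by case: o => [j|] //=; rewrite eqSS. Qed.

Definition stores (s : store) (A : nat) (f : 'I_n -> nat) : Prop :=
  forall x : 'I_n, s A x = f x.

(** The initial value n of [vBEST] is both a sentinel and the price cap: if it is still there at the
    end, every neighbour of i costs at least n and no bid is possible. *)
Lemma scan_correct (s : store) (i : 'I_n) partner price :
  rows s -> s vI 0 = i -> s vBUSY 0 = 0 -> s vBEST 0 = n ->
  stores s vPARTNER (code \o partner) -> stores s vPRICE price ->
  let s' := D scan s in
  [/\ s' vBUSY 0 = assigned partner i,
      forall j, adj G i j -> s' vBEST 0 <= price j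
    & s' vBEST 0 < n -> exists j : 'I_n,
        [/\ adj G i j, s' vBEST 0 = price j & s' vARG 0 = j]].
Proof.
move=> rs si sbusy sbest spart sprice r.
pose P k (s' : store) :=
  [/\ s' vBUSY 0 = ~~ [forall j : 'I_n, (j < k) ==> (partner j != Some i)],
      forall j : 'I_n, j < k -> adj G i j -> s' vBEST 0 <= price j
    & s' vBEST 0 < n -> exists j : 'I_n,
        [/\ adj G i j, s' vBEST 0 = price j & s' vARG 0 = j]].
suff [H1 H2 H3] : P n (D scan s).
  split=> // [|j]; last by apply: H2.
  rewrite [LHS]H1 negb_forall; congr nat_of_bool.
  by apply: eq_existsb => j; rewrite ltn_ord negbK.
apply: den_For => [|k s' fr [H1 H2 H3]].
  split=> //; last by rewrite sbest ltnn.
  by rewrite sbusy; case: forallP => // -[].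
have si' : s' vI 0 = i by rewrite fr.
have Epart : s' vPARTNER k = code (partner k) by rewrite fr // spart.
have Eprice : s' vPRICE k = price k by rewrite fr // sprice.
rewrite den_Seq [D (when (eq_expr _ _) _) _]den_when eval_eq; set s1 := if _ then _ else _.
have Ebusy : s1 vBUSY 0 = ~~ [forall j : 'I_n, (j < k.+1) ==> (partner j != Some i)].
  rewrite forall_ltS negb_and negbK.
  rewrite /s1 /= /put /= Epart si' addn1 code_eq; case: eqP => /= _.
    by rewrite orbT.
  by rewrite orbF H1.
have fr1 B x : B != vBUSY -> B != vJ -> s1 B x = s' B x.
  by rewrite /s1 => /negPf nB /negPf nJ; case: ifP => _; rewrite /= /put ?nB nJ.
have E1J : s1 vJ 0 = k by rewrite /s1; case: ifP.
have Eadj : E s1 (adj_expr (var vI) (var vJ)) = adj G i k.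
  by apply: eval_adj => [u||] //=; rewrite fr1 // fr.
rewrite den_when Eadj lt0b; case: ifP => [ik|nik]; last first.
  split=> // [j|]; rewrite fr1 //; last by rewrite fr1.
  rewrite ltnS leq_eqVlt => /orP[/eqP/ord_inj->|]; first by rewrite nik.
  exact: H2.
rewrite !denE; set s2 := put _ vARG _ _.
have Elt : (0 < E s1 (Sub (var vBEST) (Get vPRICE (var vJ)))) = (price k < s' vBEST 0).
  by rewrite /= subn_gt0 E1J !fr1 // Eprice.
rewrite Elt; case: ifP => lt.
  have E2 : s2 vBEST 0 = price k by rewrite /s2 /put /= E1J fr1.
  split=> // [j|_]; rewrite E2.
    rewrite ltnS leq_eqVlt => /orP[/eqP/ord_inj->//|ltj ij].
    exact: leq_trans (ltnW lt) (H2 j ltj ij).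
  by exists k; split=> //; rewrite /s2 /put /= E1J.
split=> // [j|]; rewrite fr1 //; last by rewrite fr1.
rewrite ltnS leq_eqVlt => /orP[/eqP/ord_inj->|]; last exact: H2.
by rewrite leqNgt lt.
Qed.

Definition settled (partner : 'I_n -> option 'I_n) (price : 'I_n -> nat) (i : 'I_n) : bool :=
  assigned partner i || [forall j, adj G i j ==> (n <= price j)].

Definition auction_store (s : store) partner price : Prop :=
  [/\ auction G partner price, stores s vPARTNER (code \o partner)
    & stores s vPRICE price].

Lemma sum_with_value (f : 'I_n -> nat) j v : f j < v ->
  \sum_x f x < \sum_x with_value f j v x.
Proof.
move=> lt; rewrite (bigD1 j) //= [X in _ < X](bigD1 j) //= {1}/with_value eqxx.
rewrite -addSn leq_add //; apply: leq_sum => x /negPf nx.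
by rewrite /with_value nx.
Qed.

Lemma bid_correct (s : store) (i : 'I_n) partner price :
  rows s -> s vI 0 = i -> auction_store s partner price ->
  (settled partner price i /\ auction_store (D bid s) partner price) \/
  (~~ settled partner price i /\ exists partner' price',
     auction_store (D bid s) partner' price' /\ \sum_x price x < \sum_x price' x).
Proof.
move=> rs si [Hauc Spart Sprice].
rewrite /bid 2!den_Seq 2!den_assign den_Seq; set s1 := put _ vBEST 0 _.
have [||||||Ebusy Hle Harg] := @scan_correct s1 i partner price; rewrite ?eval_order //.
set s2 := D scan s1 in Ebusy Hle Harg *.
have S2part : stores s2 vPARTNER (code \o partner).
  by move=> x; rewrite /s2 den_frame // -Spart.
have S2price : stores s2 vPRICE price by move=> x; rewrite /s2 den_frame // -Sprice.
rewrite den_If eval_var Ebusy lt0b; case: ifP => [busy|free].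
  by left; rewrite /settled busy.
rewrite den_when; have -> : E s2 (Sub order_expr (var vBEST)) = n - s2 vBEST 0 by [].
rewrite subn_gt0; case: ifP => [lt|ge]; last first.
  left; split=> //; rewrite /settled free /=; apply/forallP=> j; apply/implyP=> /Hle.
  by apply: leq_trans; rewrite leqNgt ge.
have [j [ij Ebest Earg]] := Harg lt.
right; split.
  rewrite /settled free /=; apply/negP=> /forallP/(_ j); rewrite ij /=.
  by rewrite -Ebest leqNgt lt.
exists (with_value partner j (Some i)), (with_value price j (price j).+1).
split; last exact: sum_with_value.
have ltp : price j < #|'I_n| by rewrite card_ord -Ebest.
have minp k : adj G i k -> price j <= price k by rewrite -Ebest; apply: Hle.
split; first by apply: auction_bid; rewrite ?free.
  rewrite !denE eval_var Earg => x; rewrite {1}/put /=.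
  have -> : s2 vI 0 = i by rewrite /s2 den_frame.
  rewrite /put /= val_eqE /with_value; case: eqP => _; first by rewrite addn1.
  exact: S2part.
rewrite !denE eval_var /= /put /= Earg Ebest addn1 => x; rewrite /= val_eqE /with_value.
by case: eqP => _; last exact: S2price.
Qed.

Definition all_settled partner price : Prop := forall i, settled partner price i.

(** As long as no bid occurs in the round the state is unchanged, so all vertices visited are
    settled in the same state. A first bid shows that this state was not settled, and it and all
    later bids only raise the sum of the prices. *)
Lemma round_correct (s : store) partner price :
  rows s -> auction_store s partner price ->
  (all_settled partner price /\ auction_store (D (For vI bid) s) partner price) \/
  (~ all_settled partner price /\ exists partner' price',
     auction_store (D (For vI bid) s) partner' price' /\
     \sum_x price x < \sum_x price' x).
Proof.
move=> rs Hs.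
pose P k (s' : store) :=
  ((forall i : 'I_n, i < k -> settled partner price i) /\ auction_store s' partner price) \/
  (~ all_settled partner price /\ exists partner' price',
     auction_store s' partner' price' /\ \sum_x price x < \sum_x price' x).
have : P n (D (For vI bid) s).
  apply: den_For => [|k s' fr H]; first by left.
  have rs' : rows (put s' vI 0 k) by move=> u; rewrite /put /= fr // rs.
  case: H => [[Hk Hs']|[unsettled [partner' [price' [Hs' lt]]]]].
    have [[set Hb]|[nset Hb]] := bid_correct rs' (erefl _ : put s' vI 0 k vI 0 = k) Hs'.
      left; split=> // i; rewrite ltnS leq_eqVlt => /orP[/eqP/ord_inj->//|].
      exact: Hk.
    by right; split=> // H; have := H k; rewrite (negPf nset).
  right; split=> //.
  have [[_ Hb]|[_ [partner'' [price'' [Hb lt']]]]] :=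
      bid_correct rs' (erefl _ : put s' vI 0 k vI 0 = k) Hs'.
    by exists partner', price'.
  by exists partner'', price''; split=> //; apply: ltn_trans lt'.
case=> [[H Hs']|]; last by right.
by left; split=> // i; apply: H.
Qed.

Lemma bidding_rounds_correct (s : store) :
  rows s -> (forall x, s vPARTNER x = 0) -> (forall x, s vPRICE x = 0) ->
  exists partner price,
    auction_store (D bidding_rounds s) partner price /\ all_settled partner price.
Proof.
move=> rs part0 price0.
pose P t (s' : store) := exists partner price, auction_store s' partner price /\
  (all_settled partner price \/ t <= \sum_x price x).
have step t (s' : store) : rows s' -> P t s' -> P t.+1 (D (For vI bid) s').
  move=> rs' [partner [price [Hs' Ht]]].
  have [[Hset H]|[nset [partner' [price' [H lt]]]]] := round_correct rs' Hs'.
    by exists partner, price; split; [|left].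
  exists partner', price'; split=> //; right.
  by case: Ht => // Ht; apply: leq_ltn_trans lt.
have start : P 0 s.
  exists (fun=> None), (fun=> 0); split; last by right.
  by split=> [|x|x]; [do 2!split | rewrite part0 | rewrite price0].
suff [partner [price [Hs [Hset|Hn]]]] : P (n * n) (D bidding_rounds s).
    by exists partner, price.
  (* Prices are at most n, so a sum of n * n forces every price to be n, and nobody can bid any
     more. *)
  exists partner, price; split=> // i; rewrite /settled; apply/orP; right.
  have [[_ Hle _ _] _ _] := Hs.
  apply/forallP=> j; apply/implyP=> _; rewrite leqNgt; apply/negP=> lt.
  move: Hn; rewrite (bigD1 j) //= leqNgt => /negP[].
  have -> : n * n = \sum_(x < n) n by rewrite sum_nat_const card_ord.
  rewrite [X in _ < X](bigD1 j) //= -addSn leq_add // leq_sum // => x _.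
  by have := Hle x; rewrite card_ord.
apply: (den_For (P := fun k => P (k * n))) => // k s' fr H.
rewrite mulSn addnC.
have rs' : rows (put s' vR 0 k) by move=> u; rewrite /put /= fr // rs.
apply: (den_For (P := fun l => P (k * n + l))) => [|l s'' fr' H'].
  by rewrite addn0.
rewrite addnS; apply: step => // u.
by rewrite /put /= fr' // -rs'.
Qed.

(** * Clauses and the search by 2-SAT tests *)

Lemma exists_ltS (Q : pred 'I_n) (k : 'I_n) :
  [exists v : 'I_n, (v < k.+1) && Q v] =
  [exists v : 'I_n, (v < k) && Q v] || Q k.
Proof.
apply/existsP/orP => [[v]|[/existsP[v /andP[lt Qv]]|Qk]].
- rewrite ltnS leq_eqVlt => /andP[/orP[/eqP/ord_inj->|lt] Qv]; first by right.
  by left; apply/existsP; exists v; rewrite lt.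
- by exists v; rewrite Qv ltnW.
- by exists k; rewrite Qk ltnSn.
Qed.

Lemma matched_clauses_correct (s : store) partner :
  stores s vPARTNER (code \o partner) -> (forall x, s vASSIGNED x = 0) ->
  s vCOUNT 0 = 0 ->
  let s' := D make_matched_clauses s in
  [/\ stores s' vW0 (code \o matched_clauses partner),
      stores s' vASSIGNED (fun i => assigned partner i : nat)
    & s' vCOUNT 0 = matching_size partner].
Proof.
move=> Spart as0 count0 r.
pose P k (s' : store) := [/\
  forall j : 'I_n, j < k -> s' vW0 j = code (matched_clauses partner j),
  forall i : 'I_n, s' vASSIGNED i =
    [exists j : 'I_n, (j < k) && (partner j == Some i)] :> nat
  & s' vCOUNT 0 = \sum_(j < n | j < k) isSome (partner j) :> nat].
suff [H1 H2 H3] : P n (D make_matched_clauses s).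
  split=> [j|i|]; first exact: H1.
    rewrite [LHS]H2; congr nat_of_bool; apply: eq_existsb => j.
    by rewrite ltn_ord.
  rewrite [LHS]H3 sum_ltn /matching_size -sum1_card [RHS]big_mkcond.
  by apply: eq_bigr => j _; rewrite inE; case: (partner j).
apply: den_For => [|k s' fr [H1 H2 H3]].
  by split=> // [i|]; rewrite ?sum_lt0 // as0; case: existsP => // -[].
have Epart : s' vPARTNER k = code (partner k) by rewrite fr // Spart.
have next (j : 'I_n) : j < k.+1 -> j = k \/ j < k.
  by rewrite ltnS leq_eqVlt => /orP[/eqP/ord_inj|]; [left|right].
rewrite den_If; have -> : E (put s' vJ 0 k) (Get vPARTNER (var vJ)) = code (partner k) by [].
case Ek: (partner k) => [i|] /=.
  rewrite /P; split.
  - move=> j /next[->|lt]; rewrite /put /= !Epart Ek /=.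
      by rewrite eqxx /matched_clauses ?Ek.
    by rewrite (ltn_eqF lt) H1.
  - move=> i'; rewrite exists_ltS /= Ek /put /= Epart Ek /= subn1 /=.
    rewrite (inj_eq (@Some_inj _)) eq_sym val_eqE; case: eqP => _; first by rewrite orbT.
    by rewrite orbF H2.
  - by rewrite sum_ltS Ek /put /= H3.
rewrite /P; split.
- move=> j /next[->|lt]; rewrite /put /=.
    by rewrite eqxx /matched_clauses ?Ek /= addn1.
  by rewrite (ltn_eqF lt) H1.
- by move=> i'; rewrite exists_ltS /= Ek orbF /put /= H2.
- by rewrite sum_ltS Ek /put /= addn0 H3.
Qed.

Lemma unassigned_clauses_correct (s : store) partner :
  stores s vASSIGNED (fun i => assigned partner i : nat) ->
  stores (D make_unassigned_clauses s) vW1 (code \o unassigned_clauses partner).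
Proof.
move=> Sas.
pose P k (s' : store) := forall j : 'I_n, j < k ->
  s' vW1 j = code (unassigned_clauses partner j).
suff H : P n (D make_unassigned_clauses s) by move=> j; apply: H.
apply: den_For => // k s' fr H j; rewrite ltnS leq_eqVlt.
have Eas : s' vASSIGNED k = assigned partner k by rewrite fr // Sas.
rewrite den_If; have -> : E (put s' vJ 0 k) (Get vASSIGNED (var vJ)) = assigned partner k by [].
rewrite lt0b !denE /= /put /= => /orP[/eqP/ord_inj->|lt].
  by rewrite /unassigned_clauses; case: (assigned partner k); rewrite /= eqxx ?addn1.
by case: ifP => _; rewrite (ltn_eqF lt) H.
Qed.

Definition marked (s : store) (x : 'I_n * bool) : bool :=
  0 < s (if x.2 then vTRUE else vFALSE) x.1.

Section Propagation.

Variables W0 W1 : 'I_n -> option 'I_n.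

Notation imp := (implication G W0 W1).

(* The second half says that the literals marked by s' are reachable from those
   marked by s, in the form needed for a single source y. *)
Definition extends (s s' : store) : Prop :=
  (forall x, marked s x -> marked s' x) /\
  (forall y, (forall x, marked s x -> connect imp y x) ->
     forall x, marked s' x -> connect imp y x).

Lemma extends_refl s : extends s s. Proof. by []. Qed.

Lemma extends_trans s1 s2 s3 : extends s1 s2 -> extends s2 s3 -> extends s1 s3.
Proof.
move=> [H1 K1] [H2 K2]; split=> [x /H1/H2//|y H].
exact: K2 (K1 y H).
Qed.

Lemma marked_put (s : store) A x v : A != vTRUE -> A != vFALSE ->
  marked (put s A x v) =1 marked s.
Proof.
move=> nT nF [u b]; rewrite /marked /put /=.
by case: b; rewrite eq_sym ?(negPf nT) ?(negPf nF).
Qed.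

Lemma extends_eq s1 s1' s2 : marked s1 =1 marked s1' ->
  extends s1 s2 -> extends s1' s2.
Proof.
move=> eq1 [H K]; split=> [x|y Hy]; first by rewrite -eq1; apply: H.
by apply: K => x; rewrite eq1; apply: Hy.
Qed.

Lemma extends_mark (s : store) (x y : 'I_n * bool) : marked s x -> imp x y ->
  let s' := put s (if y.2 then vTRUE else vFALSE) y.1 1 in
  extends s s' /\ marked s' y.
Proof.
move=> mx xy; split.
  have Em z : marked (put s (if y.2 then vTRUE else vFALSE) y.1 1) z =
              (z == y) || marked s z.
    case: y z {xy} => [u b] [v c]; rewrite /marked /put /= xpair_eqE val_eqE andbC.
    by case: b; case: c => //=; case: eqP.
  split=> [z|z H w]; rewrite Em; first by move->; rewrite orbT.
  case/orP=> [/eqP->|]; last exact: H.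
  exact: connect_trans (H _ mx) (connect1 xy).
by rewrite /marked /put; case: y.2; rewrite !eqxx.
Qed.

Lemma propagate_edges_correct (s : store) : rows s ->
  extends s (D propagate_edges s) /\
  forall u v, adj G u v -> marked s (u, false) ->
    marked (D propagate_edges s) (v, true).
Proof.
move=> rs.
pose P k (s' : store) := extends s s' /\ forall u v : 'I_n, u < k ->
  adj G u v -> marked s (u, false) -> marked s' (v, true).
suff [H1 H2] : P n (D propagate_edges s) by split=> // u v; apply: H2.
apply: den_For => [|k s' fr [H1 H2]]; first by split; first exact: extends_refl.
set s1 := put s' vI 0 k.
have eq1 : marked s' =1 marked s1 by move=> x; rewrite marked_put.
pose Q l (s'' : store) := extends s1 s'' /\ forall v : 'I_n, v < l ->
  adj G k v -> marked s1 (k, false) -> marked s'' (v, true).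
suff: Q n (D (For vJ (when (adj_expr (var vI) (var vJ))
       (when (Get vFALSE (var vI)) (Put vTRUE (var vJ) (Cst 1))))) s1).
  set s2 := D _ s1 => -[K1 K2].
  have K : extends s' s2 by apply: extends_eq K1 => x; rewrite eq1.
  split; first exact: extends_trans K.
  move=> u v; rewrite ltnS leq_eqVlt => /orP[/eqP/ord_inj->|lt] uv mu.
    by apply: K2 => //; rewrite -eq1; case: H1 => H1 _; apply: H1.
  by case: K => K _; apply: K; apply: H2 lt uv mu.
apply: den_For => [|l s'' fr' [K1 K2]]; first by split; first exact: extends_refl.
set s3 := put s'' vJ 0 l.
have eq3 : marked s'' =1 marked s3 by move=> x; rewrite marked_put.
have K3 : extends s1 s3.
  by apply: extends_trans K1 _; apply: extends_eq (extends_refl s3) => x; rewrite eq3.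
have Eadj : E s3 (adj_expr (var vI) (var vJ)) = adj G k l.
  apply: eval_adj => [u||] //; last by rewrite /= /s3 /put /= fr'.
  by rewrite /s3 /put /= fr' // /s1 /put /= fr // rs.
have E3I : s3 vI 0 = k by rewrite /s3 /put /= fr'.
rewrite !den_when Eadj lt0b.
have -> : (0 < E s3 (Get vFALSE (var vI))) = marked s3 (k, false).
  by rewrite /= E3I.
have keep (v : 'I_n) s4 : extends s3 s4 -> v < l -> adj G k v ->
    marked s1 (k, false) -> marked s4 (v, true).
  by move=> [H _] lt kv m; apply: H; rewrite -eq3; apply: K2.
case: ifP => [kl|nkl]; last first.
  split=> // v; rewrite ltnS leq_eqVlt => /orP[/eqP/ord_inj->|]; first by rewrite nkl.
  exact: keep (extends_refl _).
case: ifP => [mk|nmk]; last first.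
  split=> // v; rewrite ltnS leq_eqVlt => /orP[/eqP/ord_inj->|].
    by move=> _ m; case/negP: (negbT nmk); case: K3 => K3 _; apply: K3.
  exact: keep (extends_refl _).
have step : imp (k, false) (l, true) by rewrite /implication.
have [X M] := extends_mark mk step.
have -> : D (Put vTRUE (var vJ) (Cst 1)) s3 = put s3 vTRUE l 1 by [].
split; first exact: extends_trans X.
move=> v; rewrite ltnS leq_eqVlt => /orP[/eqP/ord_inj->//|].
exact: keep.
Qed.

Lemma extends_mark_if (b : bool) (s : store) (x y : 'I_n * bool) :
  imp x y -> b = marked s x ->
  let s' := if b then put s (if y.2 then vTRUE else vFALSE) y.1 1 else s in
  extends s s' /\ (marked s x -> marked s' y).
Proof.
move=> xy ->; case: ifP => [mx|nmx]; last by split; first exact: extends_refl.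
by have [H1 H2] := extends_mark mx xy; split.
Qed.

Lemma propagate_clauses_correct (s : store) A W :
  A \notin [:: vJ; vTRUE; vFALSE] ->
  (forall u v, W u = Some v -> linked W0 W1 u v) ->
  stores s A (code \o W) ->
  extends s (D (propagate_clauses A) s) /\
  forall u v, W u = Some v ->
    (marked s (u, true) -> marked (D (propagate_clauses A) s) (v, false)) /\
    (marked s (v, true) -> marked (D (propagate_clauses A) s) (u, false)).
Proof.
rewrite !inE !negb_or => /and3P[nJ nT nF] link SW.
have linkC u v : linked W0 W1 u v = linked W0 W1 v u.
  by rewrite /linked orbCA [(W1 u == _) || _]orbC.
pose P k (s' : store) := extends s s' /\ forall u v : 'I_n, u < k -> W u = Some v ->
  (marked s (u, true) -> marked s' (v, false)) /\
  (marked s (v, true) -> marked s' (u, false)).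
suff [H1 H2] : P n (D (propagate_clauses A) s) by split=> // u v; apply: H2.
apply: den_For => [|k s' fr [H1 H2]]; first by split; first exact: extends_refl.
set s1 := put s' vJ 0 k.
have eq1 : marked s' =1 marked s1 by move=> x; rewrite marked_put.
have X1 : extends s s1.
  by apply: extends_trans H1 _; apply: extends_eq (extends_refl s1) => x; rewrite eq1.
have E1A : E s1 (Get A (var vJ)) = code (W k).
  rewrite /= /s1 /put /= (negPf nJ) fr ?SW //.
  by rewrite !inE !negb_or nJ nF.
have keep s4 (u v : 'I_n) : extends s1 s4 -> u < k -> W u = Some v ->
    (marked s (u, true) -> marked s4 (v, false)) /\
    (marked s (v, true) -> marked s4 (u, false)).
  move=> [H _] lt Wu; have [K1 K2] := H2 u v lt Wu.
  by split=> [/K1|/K2]; rewrite eq1; apply: H.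
rewrite den_when E1A; case Wk: (W k) => [z|]; last first.
  split=> // u v; rewrite ltnS leq_eqVlt => /orP[/eqP/ord_inj->|]; first by rewrite Wk.
  exact: keep (extends_refl _).
rewrite Wk in E1A; rewrite [0 < _]/= den_Seq !den_when; set s2 := if _ then _ else s1.
have Es2 : s2 = if marked s1 (k, true) then put s1 vFALSE z 1 else s1.
  rewrite /s2 den_Put -[E s1 (Sub _ _)]/(E s1 (Get A (var vJ)) - 1) E1A.
  by rewrite -[code _ - 1]/(z.+1 - 1) subn1.
have kz : imp (k, true) (z, false) by rewrite /implication /= link.
have zk : imp (z, true) (k, false) by rewrite /implication /= linkC link.
have [X2 M2] := extends_mark_if kz (erefl (marked s1 (k, true))).
rewrite -Es2 in X2 M2.
have E2J : s2 vJ 0 = k by rewrite Es2; case: ifP.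
have E2A : s2 A k = z.+1.
  rewrite -[RHS]E1A /= Es2; case: ifP => // _.
  by rewrite /put (negPf nF).
have Ez : E s2 (Sub (Get A (var vJ)) (Cst 1)) = z by rewrite /= E2J E2A subn1.
set s3 := if _ then _ else s2.
have Es3 : s3 = if marked s2 (z, true) then put s2 vFALSE k 1 else s2.
  rewrite /s3 den_Put eval_var E2J.
  rewrite -[E s2 (Get vTRUE _)]/(s2 vTRUE (E s2 (Sub (Get A (var vJ)) (Cst 1)))).
  by rewrite Ez.
have [X3 M3] := extends_mark_if zk (erefl (marked s2 (z, true))).
rewrite -Es3 in X3 M3.
have X13 := extends_trans X2 X3; have XX := extends_trans X1 X2.
split; first exact: extends_trans X13.
move=> u v; rewrite ltnS leq_eqVlt => /orP[/eqP/ord_inj->|]; last exact: keep.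
rewrite Wk => -[<-]; split=> [mk|mz].
  by case: X3 => H _; apply: H; apply: M2; case: X1 => H _; apply: H.
by apply: M3; case: XX => H _; apply: H.
Qed.

(** One pass takes at least one step from every literal marked at its start. Updates in place may
    reach further within the pass, but [extends] keeps them among the reachable literals. *)
Lemma propagate_correct (s : store) :
  rows s -> stores s vW0 (code \o W0) -> stores s vW1 (code \o W1) ->
  extends s (D propagate s) /\
  forall x y, marked s x -> imp x y -> marked (D propagate s) y.
Proof.
move=> rs S0 S1; rewrite /propagate !den_Seq.
have [X1 H1] := propagate_edges_correct rs; set s1 := D propagate_edges s in X1 H1 *.
have S0' : stores s1 vW0 (code \o W0) by move=> x; rewrite /s1 den_frame.
have link0 u v : W0 u = Some v -> linked W0 W1 u v by rewrite /linked => ->; rewrite eqxx.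
have [X2 H2] := @propagate_clauses_correct s1 vW0 W0 isT link0 S0'.
set s2 := D _ s1 in X2 H2 *.
have S1' : stores s2 vW1 (code \o W1) by move=> x; rewrite /s2 /s1 !den_frame.
have link1 u v : W1 u = Some v -> linked W0 W1 u v.
  by rewrite /linked => ->; rewrite eqxx !orbT.
have [X3 H3] := @propagate_clauses_correct s2 vW1 W1 isT link1 S1'.
set s3 := D _ s2 in X3 H3 *.
have X12 := extends_trans X1 X2.
split; first exact: extends_trans X3.
move=> [u b] [v c] mx; rewrite /implication /=; case: b mx => mu.
  case: c => //=; rewrite /linked => /or4P[] /eqP Euv.
  - by case: X3 => H _; apply: H; apply: (H2 u v Euv).1; case: X1 => H' _; apply: H'.
  - by case: X3 => H _; apply: H; apply: (H2 v u Euv).2; case: X1 => H' _; apply: H'.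
  - by apply: (H3 u v Euv).1; case: X12 => H' _; apply: H'.
  - by apply: (H3 v u Euv).2; case: X12 => H' _; apply: H'.
case: c => //= uv.
by case: X3 => H _; apply: H; case: X2 => H' _; apply: H'; apply: H1 mu.
Qed.

Lemma clear_literals_correct (s : store) x : marked (D clear_literals s) x = false.
Proof.
pose P k (s' : store) := forall v : 'I_n, v < k -> s' vTRUE v = 0 /\ s' vFALSE v = 0.
have : P n (D clear_literals s).
  apply: den_For => // k s' fr H v; rewrite ltnS leq_eqVlt !denE /= /put /=.
  by case: eqP => //= neq /H.
by move=> /(_ x.1 (ltn_ord _))[H1 H2]; rewrite /marked; case: x.2; rewrite ?H1 ?H2.
Qed.

Lemma probe_correct (s : store) (v : 'I_n) b y :
  rows s -> stores s vW0 (code \o W0) -> stores s vW1 (code \o W1) ->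
  s vS 0 = v ->
  marked (D (probe b) s) y = connect imp (v, b) y.
Proof.
move=> rs S0 S1 sv; rewrite /probe !den_Seq.
set s1 := D _ (D _ s).
have m1 x : marked s1 x = (x == (v, b)).
  have := clear_literals_correct s x; set s0 := D clear_literals s.
  have s0v : s0 vS 0 = v by rewrite /s0 den_frame.
  rewrite /s1 -/s0 den_Put eval_var s0v; case: x => [u c].
  rewrite /marked /put /= xpair_eqE -val_eqE andbC.
  by case: (b); case: c => //=; case: eqP.
have fr1 A x : A != vTRUE -> A != vFALSE -> A != vJ -> s1 A x = s A x.
  move=> n1 n2 n3; rewrite /s1 !den_frame //= ?inE ?negb_or ?n1 ?n2 ?n3 //.
  by case: (b).
(* The marked literals lie between the ball of radius 2k and the reachable set; at k = n the radius
   is the number of literals and the two coincide. *)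
pose P k (s' : store) := (forall x, x \in ball imp (v, b) (k + k) -> marked s' x) /\
  (forall x, marked s' x -> connect imp (v, b) x).
have : P n (D (For vR (propagate ;; propagate)) s1).
  apply: den_For => [|k s' fr [H1 H2]].
    by split=> x; rewrite ?inE m1 // => /eqP->; apply: connect0.
  have fr' (A : nat) x : A \notin [:: vR; vI; vJ; vTRUE; vFALSE] -> put s' vR 0 k A x = s A x.
    rewrite !inE !negb_or => /and5P[n1 n2 n3 n4 n5].
    rewrite /put (negPf n1) fr ?fr1 // !inE !negb_or n1 n2 n3 n4 n5 //=.
  have rs' : rows (put s' vR 0 k) by move=> u; rewrite fr'.
  have S0' : stores (put s' vR 0 k) vW0 (code \o W0) by move=> u; rewrite fr'.
  have S1' : stores (put s' vR 0 k) vW1 (code \o W1) by move=> u; rewrite fr'.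
  have [X2 I2] := propagate_correct rs' S0' S1'.
  rewrite den_Seq; set s2 := D propagate _ in X2 I2 *.
  have fr2 (A : nat) x : A \notin [:: vR; vI; vJ; vTRUE; vFALSE] -> s2 A x = s A x.
    move=> nA; rewrite /s2 den_frame ?fr' //.
    by move: nA; rewrite !inE !negb_or => /and5P[n1 n2 n3 n4 n5]; rewrite n2 n3 n4 n5.
  have rs2 : rows s2 by move=> u; rewrite fr2.
  have S02 : stores s2 vW0 (code \o W0) by move=> u; rewrite fr2.
  have S12 : stores s2 vW1 (code \o W1) by move=> u; rewrite fr2.
  have [X3 I3] := propagate_correct rs2 S02 S12.
  have mk x : marked (put s' vR 0 k) x = marked s' x by rewrite marked_put.
  have step j (s4 : store) : extends s4 (D propagate s4) ->
      (forall x z, marked s4 x -> imp x z -> marked (D propagate s4) z) ->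
      (forall x, x \in ball imp (v, b) j -> marked s4 x) ->
      forall x, x \in ball imp (v, b) j.+1 -> marked (D propagate s4) x.
    move=> [X _] I H x; rewrite /= !inE => /orP[/H/X//|/exists_inP[z /H mz zx]].
    exact: I mz zx.
  split.
    rewrite addSn addnS; apply: (step _ s2 X3 I3).
    apply: (step (k + k) (put s' vR 0 k) X2 I2) => x /H1.
    by rewrite mk.
  by have [_ ] := extends_trans X2 X3; apply=> x; rewrite mk; apply: H2.
move=> [H1 H2]; apply/idP/idP => [|c]; first exact: H2.
apply: H1; have := ball_connect c.
by rewrite card_prod card_bool card_ord muln2 addnn.
Qed.

End Propagation.

Lemma two_sat_test_correct (s : store) W0 W1 :
  rows s -> stores s vW0 (code \o W0) -> stores s vW1 (code \o W1) ->
  0 < D two_sat_test s vANS 0 <-> 0 < s vANS 0 \/ satisfiable G W0 W1.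
Proof.
move=> rs S0 S1; set imp := implication G W0 W1.
pose consistent v := ~~ (connect imp (v, true) (v, false) && connect imp (v, false) (v, true)).
rewrite /two_sat_test 2!den_Seq den_assign; set s1 := put s vBAD 0 _.
pose P k (s' : store) :=
  (0 < s' vBAD 0) = ~~ [forall v : 'I_n, (v < k) ==> consistent v].
have bad : P n (D test_variables s1).
  apply: den_For => [|k s' fr H].
    by rewrite /P; case: forallP => // -[].
  rewrite 3!den_Seq; set s2 := put s' vS 0 k.
  have fr2 (A : nat) x : A \in [:: vROW; vW0; vW1] -> s2 A x = s A x.
    by rewrite !inE => /or3P[]/eqP->; rewrite /s2 /put /= fr.
  have E2 y : marked (D (probe true) s2) y = connect imp (k, true) y.
    by apply: probe_correct => // u; rewrite fr2.
  set s3 := D (probe true) s2 in E2 *.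
  rewrite den_assign eval_get; set s4 := put s3 vHIT 0 _.
  have s3S : s3 vS 0 = k by rewrite /s3 den_frame.
  have s4S : s4 vS 0 = k by [].
  have s4H : s4 vHIT 0 = s3 vFALSE k by rewrite -s3S.
  have fr4 (A : nat) x : A \in [:: vROW; vW0; vW1] -> s4 A x = s A x.
    move=> HA; rewrite -fr2 //; move: HA.
    by rewrite !inE => /or3P[]/eqP->; rewrite /s4 /put /= /s3 den_frame.
  have E4 y : marked (D (probe false) s4) y = connect imp (k, false) y.
    by apply: probe_correct => // u; rewrite fr4.
  set s5 := D (probe false) s4 in E4 *.
  have s5S : s5 vS 0 = k by rewrite /s5 den_frame.
  have s5B : s5 vBAD 0 = s' vBAD 0 by rewrite /s5 den_frame // -[LHS]/(s3 vBAD 0) /s3 den_frame.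
  have E5 : (0 < s5 vHIT 0) = connect imp (k, true) (k, false).
    by rewrite /s5 den_frame // -E2 s4H.
  rewrite !den_when den_assign !eval_var E5 eval_get eval_var s5S.
  rewrite -[0 < s5 vTRUE k]/(marked s5 (k, true)) E4.
  rewrite /P forall_ltS negb_and negbK -H /consistent -s5B.
  case: (connect imp _ _) => /=; last by rewrite orbF.
  by case: (connect imp _ _) => /=; rewrite ?orbF ?orbT.
rewrite den_If eval_var bad; set s2 := D test_variables s1.
have E2 : s2 vANS 0 = s vANS 0 by rewrite /s2 den_frame.
have -> : [forall v : 'I_n, (v < n) ==> consistent v] = [forall v, consistent v].
  by apply: eq_forallb => v; rewrite ltn_ord.
rewrite satisfiable_connect; case: forallP => /= H; first by split=> // _; right.
by rewrite E2; split=> [|[|]//]; left.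
Qed.

(** The clauses W0 and W1 are read off the store with cell t of A zeroed, 0 being the code of
    [None]; this treats both clause arrays at once. The second half states the restoration, which
    makes the tests independent. *)
Lemma exempt_correct (s : store) A (t : 'I_n) W0 W1 :
  A \in [:: vW0; vW1] -> rows s -> s vT 0 = t ->
  stores (put s A t 0) vW0 (code \o W0) -> stores (put s A t 0) vW1 (code \o W1) ->
  (0 < D (exempt A) s vANS 0 <-> 0 < s vANS 0 \/ satisfiable G W0 W1) /\
  forall B x, B \in [:: vROW; vT; vW0; vW1] -> D (exempt A) s B x = s B x.
Proof.
move=> HA rs st S0 S1; rewrite /exempt 3!den_Seq den_assign eval_get eval_var st.
set s1 := put s vSAVE 0 _.
have s1T : s1 vT 0 = t by [].
rewrite !den_Put !eval_var s1T [E s1 _]/=.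
set s2 := put s1 A t 0.
have S2 (B : nat) f : B != vSAVE -> stores (put s A t 0) B f -> stores s2 B f.
  by move=> /negPf nB H x; rewrite -H /s2 /s1 /put nB.
have rs2 : rows s2.
  by move=> u; rewrite -rs /s2 /put; move: HA; rewrite !inE => /orP[]/eqP->.
have Hans := two_sat_test_correct rs2 (S2 vW0 _ isT S0) (S2 vW1 _ isT S1).
set s3 := D two_sat_test s2 in Hans *.
have fr3 (B : nat) x : B \in [:: vROW; vT; vW0; vW1; vSAVE] -> s3 B x = s2 B x.
  rewrite !inE => HB; rewrite /s3 den_frame //.
  by case/or4P: HB => [/eqP->|/eqP->|/eqP->|/orP[]/eqP->].
have nA : (vANS == A) = false /\ (vSAVE == A) = false /\ (vT == A) = false.
  by move: HA; rewrite !inE => /orP[]/eqP->.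
have [nA1 [nA2 nA3]] := nA.
have s3T : s3 vT 0 = t by rewrite fr3 // /s2 /put nA3.
have s3S : s3 vSAVE 0 = s A t by rewrite fr3 // /s2 /put nA2.
split; first by rewrite {1}/put nA1 /=; move: Hans; rewrite {1}/s2 /put nA1.
move=> B x HB; rewrite /put s3T s3S; case: ifP => [/andP[/eqP-> /eqP->]//|neq].
rewrite fr3; last by move: HB; rewrite !inE => /or4P[]->; rewrite ?orbT.
rewrite /s2 /put neq /s1 /put; move: HB; rewrite !inE.
by case/or4P=> /eqP->.
Qed.

Lemma search_correct (s : store) W0 W1 :
  rows s -> stores s vW0 (code \o W0) -> stores s vW1 (code \o W1) ->
  s vANS 0 = 0 ->
  0 < D search s vANS 0 <-> exists t, satisfiable G (with_value W0 t None) W1 \/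
                                     satisfiable G W0 (with_value W1 t None).
Proof.
move=> rs S0 S1 ans0.
pose sat t := satisfiable G (with_value W0 t None) W1 \/ satisfiable G W0 (with_value W1 t None).
pose P k (s' : store) :=
  (forall B x, B \in [:: vROW; vW0; vW1] -> s' B x = s B x) /\
  (0 < s' vANS 0 <-> exists2 t : 'I_n, t < k & sat t).
suff [_ ->] : P n (D search s) by split=> [[t _]|[t]]; exists t.
apply: den_For => [|k s' _ [fr Hans]].
  by split=> //; rewrite ans0; split=> // -[].
set s1 := put s' vT 0 k.
have fr1 (B : nat) x : B \in [:: vROW; vW0; vW1] -> s1 B x = s B x.
  by move=> HB; rewrite -fr //; move: HB; rewrite !inE => /or3P[]/eqP->.
have zero (s2 : store) A W : stores s2 A (code \o W) ->
    stores (put s2 A k 0) A (code \o with_value W k None).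
  move=> H x; rewrite /put eqxx /= val_eqE /with_value.
  by case: eqP => // _; apply: H.
rewrite den_Seq.
have rs1 : rows s1 by move=> u; rewrite fr1.
have S01 : stores s1 vW0 (code \o W0) by move=> u; rewrite fr1.
have S11 : stores s1 vW1 (code \o W1) by move=> u; rewrite fr1.
have [A2 fr2] := @exempt_correct s1 vW0 k (with_value W0 k None) W1
  isT rs1 erefl (zero _ _ _ S01) S11.
set s2 := D (exempt vW0) s1 in A2 fr2 *.
have rs2 : rows s2 by move=> u; rewrite fr2.
have S02 : stores s2 vW0 (code \o W0) by move=> u; rewrite fr2.
have S12 : stores s2 vW1 (code \o W1) by move=> u; rewrite fr2.
have s2T : s2 vT 0 = k by rewrite fr2.
have [A3 fr3] := @exempt_correct s2 vW1 k W0 (with_value W1 k None)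
  isT rs2 s2T S02 (zero _ _ _ S12).
split=> [B x HB|].
  have HB' : B \in [:: vROW; vT; vW0; vW1].
    by move: HB; rewrite !inE => /or3P[]->; rewrite ?orbT.
  by rewrite fr3 // fr2 // fr1.
rewrite A3 A2 -[s1 vANS 0]/(s' vANS 0) Hans; split.
  case=> [[[t lt Ht]|H]|H].
  - by exists t => //; apply: ltnW.
  - by exists k => //; left.
  - by exists k => //; right.
case=> t; rewrite ltnS leq_eqVlt => /orP[/eqP/ord_inj->|lt] Ht; last by left; left; exists t.
by case: Ht => Ht; [left; right | right].
Qed.

Lemma decide_correct : 0 < n ->
  E (D decide (fun _ _ => 0)) verdict =
  (independence_number G == annihilation_number G).
Proof.
move=> n_gt0; set s0 : store := fun _ _ => 0.
rewrite /decide 6!den_Seq.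
have rs1 := index_rows_correct s0; set s1 := D index_rows s0 in rs1 *.
(* The program relies on starting from zeros: counters and degrees are never initialised, and zero
   partners and prices encode the empty matching at price 0. *)
have z1 A x : A \notin [:: vROW; vTMP; vI] -> s1 A x = 0.
  by rewrite !inE !negb_or => /and3P[n1 n2 n3]; rewrite /s1 den_frame // !inE !negb_or n1 n2 n3.
have [deg2 tot2] := degrees_correct rs1 (fun v => z1 vDEG v isT) (z1 vTOT 0 isT).
set s2 := D degrees s1 in deg2 tot2 *.
have ann2 : s2 vANN 0 = 0 by rewrite /s2 den_frame // z1.
have ann3 := annihilate_correct deg2 tot2 ann2.
set s3 := D annihilate s2 in ann3 *.
have rs3 : rows s3 by move=> u; rewrite /s3 /s2 !den_frame.
have part3 x : s3 vPARTNER x = 0 by rewrite /s3 /s2 !den_frame // z1.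
have price3 x : s3 vPRICE x = 0 by rewrite /s3 /s2 !den_frame // z1.
have [partner [price [[Hauc part4 _] settled4]]] := bidding_rounds_correct rs3 part3 price3.
set s4 := D bidding_rounds s3 in part4 *.
have as4 x : s4 vASSIGNED x = 0 by rewrite /s4 /s3 /s2 !den_frame // z1.
have count4 : s4 vCOUNT 0 = 0 by rewrite /s4 /s3 /s2 !den_frame // z1.
have [S05 as5 count5] := matched_clauses_correct part4 as4 count4.
set s5 := D make_matched_clauses s4 in S05 as5 count5 *.
have S16 := unassigned_clauses_correct as5.
set s6 := D make_unassigned_clauses s5 in S16 *.
have S06 : stores s6 vW0 (code \o matched_clauses partner).
  by move=> x; rewrite /s6 den_frame.
have rs6 : rows s6 by move=> x; rewrite /s6 /s5 /s4 !den_frame.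
have ans6 : s6 vANS 0 = 0 by rewrite /s6 /s5 /s4 /s3 /s2 !den_frame // z1.
have := search_correct rs6 S06 S16 ans6; set s7 := D search s6 => Hans.
have count7 : s7 vCOUNT 0 = matching_size partner by rewrite /s7 /s6 !den_frame.
have ann7 : s7 vANN 0 = annihilation_number G.
  by rewrite /s7 /s6 /s5 /s4 !den_frame.
have stable i j : ~~ assigned partner i -> adj G i j -> #|'I_n| <= price j.
  move=> free ij; have := settled4 i; rewrite /settled (negPf free) card_ord /=.
  by move=> /forallP/(_ j); rewrite ij.
have V_gt0 : 0 < #|'I_n| by rewrite card_ord.
have Heq : independence_number G = annihilation_number G <->
    matching_size partner + 2 * annihilation_number G <= 2 * n /\ 0 < s7 vANS 0.
  by rewrite Hans (independence_eq_annihilation V_gt0 Hauc stable) card_ord.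
rewrite -[E s7 verdict]/(E s7 (le_expr (Cst 1) (var vANS)) +
  E s7 (le_expr (Add (var vCOUNT) (Add (var vANN) (var vANN))) (Add order_expr order_expr)) - 1).
rewrite !eval_le -[E s7 (Cst 1)]/1 eval_var.
rewrite -[E s7 (Add (var vCOUNT) _)]/(s7 vCOUNT 0 + (s7 vANN 0 + s7 vANN 0)).
rewrite -[E s7 (Add order_expr _)]/(n + n) count7 ann7 !addnn -!mul2n.
case: eqP => [/Heq[-> ->]//|neq].
case ans: (0 < s7 vANS 0); case small: (_ <= 2 * n) => //.
by case: neq; apply/Heq.
Qed.

End Correctness.

Theorem theorem1 :
  exists (p : program) (q : {poly nat}),
    forall (n : nat) (G : sgraph 'I_n),
      0 < n ->
      answers_within p (encode G) (q.[graph_size G])%R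
        (independence_number G == annihilation_number G).
Proof.
have [q Hq] := compile_polynomial decide verdict.
exists (compile 0 0 decide ++ compile_expr 0 verdict), q => n G n_gt0.
have /andP[okc oke] := decide_ok.
apply: compile_answers => //; last exact: decide_correct.
exact: Hq.
Qed.
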